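(* Let $p\in\mathbb{C}[z]$ be a polynomial with only simple zeros and $\deg(p)\geq 4$, and let $D_p=\{(x,y,z)\in\mathbb{C}^3: xy=p(z)\}$. The holomorphic automorphism $$(x,y,z)\mapsto (xe^{z},\,ye^{-z},\,z)$$ of $D_p$ is not contained in the overshear group $\mathrm{OS}(D_p)$; thus $\mathrm{OS}(D_p)$ is a proper subgroup of the group of holomorphic automorphisms of $D_p$.
   Context: $I:D_p\to D_p$ is the involution $I(x,y,z)=(y,x,z)$. For holomorphic $f,g:\mathbb{C}\to\mathbb{C}$, the map $O_{f,g}:D_p\to D_p$ is $$O_{f,g}(x,y,z)=\left(x,\; y+\tfrac1x\left(p(ze^{xf(x)}+xg(x))-p(z)\right),\; ze^{xf(x)}+xg(x)\right),$$ where the second component is extended holomorphically across $x=0$; it is a holomorphic automorphism of $D_p$. The maps $O_{f,g}$ and $I\circ O_{f,g}\circ I$ are called overshear maps. The overshear group $\mathrm{OS}(D_p)$ is the subgroup of the group of holomorphic automorphisms of $D_p$ generated by all overshear maps. *)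

(* Defs.v *)
From mathcomp Require Export all_boot all_order all_algebra.
From mathcomp Require Export complex.
From mathcomp Require Export all_classical all_reals all_analysis.
From mathcomp Require Import ring.
Set Implicit Arguments.
Unset Strict Implicit.
Unset Printing Implicit Defensive.
Import Order.TTheory GRing.Theory Num.Theory.
Export numFieldNormedType.Exports.
Local Open Scope classical_set_scope.
Local Open Scope ring_scope.

(* Going through [numClosedFieldType] makes the normed-space and topological
   structures of a numeric field available on the type of complex numbers. *)
Definition CC (R : realType) : numClosedFieldType := R[i].

Definition cexp (R : realType) (z : CC R) : CC R :=
  Complex (expR (complex.Re z) * cos (complex.Im z))
          (expR (complex.Re z) * sin (complex.Im z)).

Lemma cexpK (R : realType) (z : CC R) : cexp z * cexp (- z) = 1.
Proof.
case: z => a b; rewrite /cexp; apply/eqP; rewrite eq_complex /=.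
rewrite cosN sinN expRN.
have e0 : expR a != 0 by rewrite gt_eqF ?expR_gt0.
apply/andP; split; apply/eqP; last by rewrite mulrN; ring.
rewrite [RHS](_ : _ = expR a / expR a * (cos b ^+ 2 + sin b ^+ 2)).
  by ring.
by rewrite cos2Dsin2 mulr1 divff.
Qed.

Definition entire (R : realType) (f : CC R -> CC R) : Prop :=
  forall z, differentiable f z.

Section Danielewski.
Variables (R : realType) (p : {poly CC R}).
Local Notation C := (CC R).

Definition on_danielewski (v : C * C * C) : bool :=
  let: (x, y, z) := v in x * y == p.[z].

Definition danielewski := {v : C * C * C | on_danielewski v}.

(* [danielewski] is a closed submanifold of C^3 when [p] has simple zeros;
   self-maps are holomorphic when they locally extend to holomorphic maps
   between open subsets of C^3. *)
Definition holomorphic (phi : danielewski -> danielewski) : Prop :=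
  forall v : danielewski, exists F : C * C * C -> C * C * C,
    \forall u \near val v,
      differentiable F u /\
      (forall w : danielewski, val w = u -> val (phi w) = F u).

Definition hol_aut : set (danielewski -> danielewski) :=
  [set phi | holomorphic phi /\
     exists psi, [/\ holomorphic psi, cancel phi psi & cancel psi phi]].

Definition is_subgroup (G S : set (danielewski -> danielewski)) : Prop :=
  [/\ S `<=` G,
      S id,
      (forall phi psi, S phi -> S psi -> S (phi \o psi)) &
      (forall phi psi, S phi -> cancel phi psi -> cancel psi phi -> S psi)].

Definition swap_fun (v : C * C * C) : C * C * C :=
  let: (x, y, z) := v in (y, x, z).

Lemma swap_subproof (v : danielewski) : on_danielewski (swap_fun (val v)).
Proof. by case: v => -[[x y] z] /=; rewrite mulrC. Qed.

Definition swap (v : danielewski) : danielewski := exist on_danielewski _ (swap_subproof v).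

(* With Z := z * e^(x f(x)) + x * g(x) = z + x * (z * f(0) + g(0)) + O(x^2),
   the quotient (p(Z) - p(z)) / x tends to p'(z) * (z * f(0) + g(0)) as x
   tends to 0: this is the value of its holomorphic extension at x = 0. *)
Definition overshear_fun (f g : C -> C) (v : C * C * C) : C * C * C :=
  let: (x, y, z) := v in
  let Z := z * cexp (x * f x) + x * g x in
  (x,
   y + (if x == 0 then p^`().[z] * (z * f 0 + g 0) else x^-1 * (p.[Z] - p.[z])),
   Z).

Lemma overshear_subproof (f g : C -> C) (v : danielewski) :
  on_danielewski (overshear_fun f g (val v)).
Proof.
case: v => -[[x y] z] /= /eqP e; have [x0|x0] := eqVneq x 0.
  have c0 : cexp (0 : C) = 1.
    by apply/eqP; rewrite eq_complex /= expR0 cos0 sin0 !mul1r !eqxx.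
  by move: e; rewrite x0 !mul0r c0 mulr1 addr0 => <-.
by rewrite mulrDr mulrA divff // mul1r e addrC subrK.
Qed.

Definition overshear (f g : C -> C) (v : danielewski) : danielewski :=
  exist on_danielewski _ (overshear_subproof f g v).

Definition overshears : set (danielewski -> danielewski) :=
  [set phi | exists f g, [/\ entire f, entire g &
     phi = overshear f g \/ phi = swap \o overshear f g \o swap]].

Definition overshear_group : set (danielewski -> danielewski) :=
  smallest (is_subgroup hol_aut) overshears.

Definition exp_fun (v : C * C * C) : C * C * C :=
  let: (x, y, z) := v in (x * cexp z, y * cexp (- z), z).

Lemma exp_subproof (v : danielewski) : on_danielewski (exp_fun (val v)).
Proof.
by case: v => -[[x y] z] /= /eqP <-; rewrite mulrACA cexpK mulr1.
Qed.

Definition exp_map (v : danielewski) : danielewski :=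
  exist on_danielewski _ (exp_subproof v).

End Danielewski.

Arguments hol_aut {R} p.
Arguments is_subgroup {R p}.
Arguments overshear_group {R} p.
Arguments exp_map {R} p.

(* Main.v *)
Require Import Defs.
From mathcomp Require Import ring lra.
Set Implicit Arguments.
Unset Strict Implicit.
Unset Printing Implicit Defensive.
Import Order.TTheory GRing.Theory Num.Theory.
Local Open Scope classical_set_scope.
Local Open Scope ring_scope.

(** The overshears fixing [x] form a group, and so do those fixing [y]; hence a
    product of overshears is a word whose letters are non-trivial and fix [x]
    and [y] alternately ([reduce_word]).  Follow an entire curve in the surface
    through such a word.  A letter fixing the coordinate [u] replaces [z] by
    [z' = z + u * q] with [q] entire, and the other coordinate [v = p(z) / u] by
    [v' = p(z') / u]; the next letter fixes [v'].  Let [m(h)] be the mean of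
    [log^+ |h|] over a large circle.  Up to bounded terms,
    - [4 m(z) <= m(u) + m(v)], because [u * v = p(z)] and [deg p >= 4]
      ([prox_horner]);
    - [m(u) <= m(z') + m(z)], whenever [q(0) != 0] ([prox_le]).
    If [m(v) <= m(u)] these give [m(z) <= m(u) / 2] and [m(z') >= m(u) / 2], then
    [m(v') >= 4 m(z') - m(u) >= m(u)], so the situation reproduces itself at the
    next letter, and the last value of [z] satisfies [m(u) <= 2 m(z)] for the
    initial [u] ([growth]).  On the curve [(x0 e^t, y0 e^-t, z0)] the first two
    coordinates have comparable unbounded means, whereas the exponential map
    leaves [z] equal to the constant [z0]: it is not a word.

    The estimate [prox_le] is Jensen's inequality
    [log |q(0)| <= mean of log |q|] for [q = (z' - z) / u]: its modulus is
    at most [(|z'| + |z|) / |u|] where [|u| >= 1], and is bounded in terms of [z]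
    where [|u| <= 1].
    Averaging over finitely many points of the circle reduces Jensen's inequality
    to the maximum principle for a product of rotations of [q] ([jensen]), and
    the maximum principle follows from Goursat's bisection in logarithmic polar
    coordinates, where a circle is a side of a rectangle ([rect_int_eq0],
    [max_principle]).

    The base point of the curve must make [q(0)] non-zero for every letter.  Such
    points are dense ([generic_dense]) by the identity theorem; the simplicity of
    the zeros of [p] makes it possible to leave the lines [x = 0] and [y = 0].

    That overshears are automorphisms at all comes from a formula without
    division, in which the divided difference of [p] and the entire function
    [(e^w - 1) / w] absorb the factor [1 / x] ([oshear]). *)

(** * The modulus of a complex number *)

Lemma quotient_errE (K : fieldType) (D h a : K) : h != 0 ->
  D - h^-1 * a = - (h^-1 * (a - D * h)).
Proof. by move=> h0; rewrite mulrBr (mulrC D) mulKf// opprB. Qed.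

Section Modulus.
Variable R : realType.
Local Notation C := (CC R).
Implicit Types z w : C.

(** The norm of [CC R] takes values in [CC R]; [cmod] is the same number in [R]. *)
Definition cmod z : R := ComplexField.Normc.normc z.
Arguments cmod : simpl never.

Lemma normE z : `|z| = real_complex R (cmod z).
Proof. by []. Qed.

Lemma cmodM z w : cmod (z * w) = cmod z * cmod w.
Proof. exact: ComplexField.Normc.normcM. Qed.

Lemma cmodD z w : cmod (z + w) <= cmod z + cmod w.
Proof. exact: le_normcD. Qed.

Lemma cmodN z : cmod (- z) = cmod z.
Proof. exact: normcN. Qed.

Lemma cmod_ge0 z : 0 <= cmod z.
Proof. by rewrite -lecR -normE normr_ge0. Qed.

Lemma cmod0 : cmod 0 = 0.
Proof. exact: ComplexField.Normc.normc0. Qed.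

Lemma cmod1 : cmod 1 = 1.
Proof. exact: ComplexField.Normc.normc1. Qed.

Lemma cmod_eq0 z : (cmod z == 0) = (z == 0).
Proof.
apply/idP/idP => [/eqP/ComplexField.Normc.eq0_normc -> //|/eqP ->].
by rewrite cmod0.
Qed.

Lemma cmod_gt0 z : (0 < cmod z) = (z != 0).
Proof. by rewrite lt_def cmod_ge0 cmod_eq0 andbT. Qed.

Lemma cmodV z : cmod z^-1 = (cmod z)^-1.
Proof. exact: ComplexField.Normc.normcV. Qed.

Lemma cmodX z n : cmod (z ^+ n) = cmod z ^+ n.
Proof. by elim: n => [|n IH]; rewrite ?expr0 ?cmod1// !exprS cmodM IH. Qed.

Lemma cmodB z w : cmod (z - w) <= cmod z + cmod w.
Proof. by rewrite (le_trans (cmodD _ _))// cmodN. Qed.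

Lemma cmodC z w : cmod (z - w) = cmod (w - z).
Proof. by rewrite -opprB cmodN. Qed.

Lemma cmod_leD z w : cmod z <= cmod (z - w) + cmod w.
Proof. by have := cmodD (z - w) w; rewrite subrK. Qed.

Lemma cmod_prod (I : Type) (s : seq I) (F : I -> C) :
  cmod (\prod_(i <- s) F i) = \prod_(i <- s) cmod (F i).
Proof. by apply: (big_morph _ cmodM cmod1). Qed.

Lemma cmodE (a b : R) : cmod (Complex a b) = Num.sqrt (a ^+ 2 + b ^+ 2).
Proof. by []. Qed.

Lemma cmod_le_ReIm (a b : R) : cmod (Complex a b) <= `|a| + `|b|.
Proof.
rewrite cmodE -[leRHS]ger0_norm ?addr_ge0// -sqrtr_sqr ler_wsqrtr//.
rewrite sqrrD !real_normK ?num_real// lerD2r lerDl mulrn_wge0//.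
Qed.

Lemma Re_le_cmod z : `|complex.Re z| <= cmod z.
Proof.
case: z => a b /=; rewrite cmodE -sqrtr_sqr ler_wsqrtr// lerDl sqr_ge0 //.
Qed.

Lemma Im_le_cmod z : `|complex.Im z| <= cmod z.
Proof.
case: z => a b /=; rewrite cmodE -sqrtr_sqr ler_wsqrtr// lerDr sqr_ge0 //.
Qed.

Lemma ReB z w : complex.Re (z - w) = complex.Re z - complex.Re w.
Proof. by case: z w => [a b] [c d]. Qed.

Lemma ImB z w : complex.Im (z - w) = complex.Im z - complex.Im w.
Proof. by case: z w => [a b] [c d]. Qed.

Lemma gt0_complexP (e : C) : 0 < e -> 0 < complex.Re e /\ e = real_complex R (complex.Re e).
Proof. by case: e => a b; rewrite ltcE/= => /andP[/eqP -> ?]; split. Qed.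

Lemma nbhs_cmodP z (P : set C) :
  nbhs z P <-> exists2 d : R, 0 < d & forall w, cmod (w - z) < d -> P w.
Proof.
split.
- move=> /nbhs_normP[e /= /gt0_complexP[e0 ee] H]; exists (complex.Re e) => // w wz.
  by apply: H; rewrite /ball_/= normE ee ltcR cmodC.
- move=> [d d0 H]; apply/nbhs_normP; exists (real_complex R d) => /=.
    by rewrite ltcR.
  by move=> w; rewrite /ball_/= normE ltcR cmodC => /H.
Qed.

Lemma continuous_cmodP (f : C -> C) z : {for z, continuous f} <->
  forall e : R, 0 < e -> exists2 d : R, 0 < d &
    forall w, cmod (w - z) < d -> cmod (f w - f z) < e.
Proof.
split=> [H e e0|H].
- have : nbhs (f z) [set w | cmod (w - f z) < e].
    by apply/nbhs_cmodP; exists e.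
  by move=> /H; rewrite /nbhs/= => /nbhs_cmodP.
- move=> P /nbhs_cmodP[e e0 HP]; have [d d0 Hd] := H e e0.
  apply/nbhs_cmodP; exists d => // w /Hd; exact: HP.
Qed.

Lemma differentiable_cmodP (f : C -> C) z : differentiable f z <->
  exists D : C, forall e : R, 0 < e -> exists2 d : R, 0 < d &
    forall h, cmod h < d -> cmod (f (h + z) - f z - D * h) <= e * cmod h.
Proof.
rewrite -derivable1_diffP; split.
- move=> /cvg_ex[/= D /(@cvgrPdist_lt C C^o _ _ _ _ _) HD]; exists D => e e0.
  have /HD : 0 < real_complex R e by rewrite ltcR.
  move=> /nbhs_cmodP[d d0 Hd]; exists d => // h hd.
  have [->|h0] := eqVneq h 0.
    by rewrite add0r subrr mulr0 subr0 cmod0 mulr0.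
  have := Hd h; rewrite subr0 => /(_ hd h0).
  rewrite normE ltcR.
  have -> : D - h^-1 *: ((f \o shift z) (h *: 1) - f z)
     = - (h^-1 * (f (h + z) - f z - D * h)).
    rewrite /= [h *: 1]mulr1.
    exact: quotient_errE h0.
  rewrite cmodN cmodM cmodV => /ltW.
  by rewrite mulrC ler_pdivrMr ?cmod_gt0.
- move=> [D HD]; apply/cvg_ex; exists D; apply/(@cvgrPdist_lt C C^o) => e /gt0_complexP[e0 ee].
  have [d d0 Hd] := HD (complex.Re e / 2) (divr_gt0 e0 (ltr0n R 2)).
  apply/nbhs_cmodP; exists d => // h; rewrite subr0 => /Hd {}Hd h0.
  rewrite normE ee ltcR.
  have -> : D - h^-1 *: ((f \o shift z) (h *: 1) - f z)
     = - (h^-1 * (f (h + z) - f z - D * h)).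
    rewrite /= [h *: 1]mulr1.
    exact: quotient_errE h0.
  rewrite cmodN cmodM cmodV mulrC ltr_pdivrMr ?cmod_gt0//.
  by rewrite (le_lt_trans Hd)// ltr_pM2r ?cmod_gt0// ltr_pdivrMr// ltr_pMr// ltr1n.
Qed.

End Modulus.
Arguments cmod : simpl never.

(** * Holomorphic maps *)

Section Holomorphic.
Variable R : realType.
Local Notation C := (CC R).

(** For [V = W = C] this unfolds to [entire]. *)
Definition hol (V W : normedModType C) (F : V -> W) := forall v, differentiable F v.

Lemma hol_continuous (V W : normedModType C) (F : V -> W) : hol F -> continuous F.
Proof. by move=> hF v; exact: differentiable_continuous. Qed.

Lemma hol_comp (U V W : normedModType C) (G : V -> W) (F : U -> V) :
  hol G -> hol F -> hol (fun v => G (F v)).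
Proof. by move=> hG hF v; apply: differentiable_comp; [exact: hF|exact: hG]. Qed.

Section Operations.
Variable V : normedModType C.
Implicit Types F G : V -> C.

Lemma hol_id : hol (@id V).
Proof. by move=> v; exact: ex_diff. Qed.

Lemma hol_cst (W : normedModType C) (c : W) : hol (fun _ : V => c).
Proof. by move=> v; exact: differentiable_cst. Qed.

Lemma hol_fst (W W' : normedModType C) (F : V -> W * W') : hol F -> hol (fun v => (F v).1).
Proof.
move=> hF v; apply: differentiable_comp; first exact: hF.
have cf : continuous (@fst W W') by move=> x; exact: cvg_fst.
exact: (@linear_differentiable _ _ _ (@fst W W') (F v) cf).
Qed.

Lemma hol_snd (W W' : normedModType C) (F : V -> W * W') : hol F -> hol (fun v => (F v).2).
Proof.
move=> hF v; apply: differentiable_comp; first exact: hF.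
have cf : continuous (@snd W W') by move=> x; exact: cvg_snd.
exact: (@linear_differentiable _ _ _ (@snd W W') (F v) cf).
Qed.

Lemma hol_pair (W W' : normedModType C) (F : V -> W) (G : V -> W') :
  hol F -> hol G -> hol (fun v => (F v, G v)).
Proof. by move=> hF hG v; exact: differentiable_pair. Qed.

Lemma holD F G : hol F -> hol G -> hol (fun v => F v + G v).
Proof. by move=> hF hG v; exact: differentiableD. Qed.

Lemma holN F : hol F -> hol (fun v => - F v).
Proof. by move=> hF v; exact: differentiableN. Qed.

Lemma holM F G : hol F -> hol G -> hol (fun v => F v * G v).
Proof. by move=> hF hG v; exact: differentiableM. Qed.

Lemma holX F n : hol F -> hol (fun v => F v ^+ n).
Proof.
move=> hF; elim: n => [|n IH]; first by under eq_fun do rewrite expr0; exact: hol_cst.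
by under eq_fun do rewrite exprS; exact: holM.
Qed.

Lemma hol_sum n (F : 'I_n -> V -> C) :
  (forall i, hol (F i)) -> hol (fun v => \sum_(i < n) F i v).
Proof.
elim: n F => [|n IH] F hF; first by under eq_fun do rewrite big_ord0; exact: hol_cst.
under eq_fun do rewrite big_ord_recr/=.
exact: holD (IH _ (fun i => hF _)) (hF _).
Qed.

Lemma hol_prod (I : Type) (s : seq I) (F : I -> V -> C) :
  (forall i, hol (F i)) -> hol (fun v => \prod_(i <- s) F i v).
Proof.
move=> hF; elim: s => [|i s IH]; first by under eq_fun do rewrite big_nil; exact: hol_cst.
by under eq_fun do rewrite big_cons; exact: holM.
Qed.

End Operations.
End Holomorphic.
Arguments hol_id {R V}.
Arguments hol_cst {R V W} c.

(** * Taylor estimates for the exponential *)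

Section RealTaylor.
Variable R : realType.
Implicit Types (f g : R -> R) (x K : R).

(** Successive integrations by the mean value theorem turn a bound on the last
    derivative into a Taylor estimate. *)
Lemma is_derive_bound_pow f g K n :
  (forall x, is_derive x (1 : R) f (g x)) -> f 0 = 0 ->
  (forall x, `|x| <= 1 -> `|g x| <= K * `|x| ^+ n) ->
  forall x, `|x| <= 1 -> `|f x| <= K * `|x| ^+ n.+1.
Proof.
move=> df f0 gK x x1.
have [c cx e] : exists2 c : R, `|c| <= `|x| & f x = g c * x.
  have cf a b : {within `[a, b], continuous f}.
    apply: continuous_subspaceT => y.
    by apply: differentiable_continuous; apply/derivable1_diffP.
  have [x0|x0] := leP 0 x.
    have [c] := MVT_segment x0 (fun y _ => df y) (cf _ _).
    rewrite in_itv/= f0 !subr0 => /andP[c0 cx] ->; exists c => //.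
    by rewrite !ger0_norm.
  have [c] := MVT_segment (ltW x0) (fun y _ => df y) (cf _ _).
  rewrite in_itv/= f0 !sub0r mulrN => /andP[c0 cx] /oppr_inj ->; exists c => //.
  by rewrite !ler0_norm ?lerN2// ltW.
rewrite e normrM exprSr mulrA ler_wpM2r//.
rewrite (le_trans (gK _ (le_trans cx x1)))//.
have K0 : 0 <= K.
  by have := gK 1; rewrite normr1 lexx expr1n mulr1 => /(_ isT); apply: le_trans.
by rewrite ler_wpM2l// lerXn2r// nnegrE.
Qed.

Lemma expR_taylor2 x : `|x| <= 1 ->
  `|expR x - 1 - x - x ^+ 2 / 2| <= expR 1 * `|x| ^+ 3.
Proof.
have d0 (y : R) : `|y| <= 1 -> `|expR y| <= expR (1 : R) * `|y| ^+ 0.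
  move=> y1; rewrite expr0 mulr1 ger0_norm ?expR_ge0// ler_expR.
  by rewrite (le_trans _ y1)// ler_norm.
have d1 (y : R) : `|y| <= 1 -> `|expR y - 1| <= expR (1 : R) * `|y| ^+ 1.
  move: y; apply: is_derive_bound_pow d0; last by rewrite expR0 subrr.
  by move=> y; apply: is_derive_eq; rewrite subr0.
have d2 (y : R) : `|y| <= 1 -> `|expR y - 1 - y| <= expR (1 : R) * `|y| ^+ 2.
  move: y; apply: is_derive_bound_pow d1; last by rewrite expR0 subrr subr0.
  by move=> y; apply: is_derive_eq; rewrite subr0.
move: x; apply: is_derive_bound_pow d2; last by rewrite expR0; ring.
move=> y; apply: is_derive_eq; by rewrite /GRing.scale/=; field.
Qed.

Lemma sin_taylor x : `|x| <= 1 -> `|sin x - x| <= 1 * `|x| ^+ 3.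
Proof.
have d0 (y : R) : `|y| <= 1 -> `|cos y| <= 1 * `|y| ^+ 0.
  move=> y1; rewrite expr0 mulr1 ler_norml; apply/andP; split.
    exact: cos_geN1.
  exact: cos_le1.
have d1 (y : R) : `|y| <= 1 -> `|- sin y| <= 1 * `|y| ^+ 1.
  rewrite normrN; move: y; apply: is_derive_bound_pow d0; exact: sin0.
have d2 (y : R) : `|y| <= 1 -> `|cos y - 1| <= 1 * `|y| ^+ 2.
  move: y; apply: is_derive_bound_pow d1; last by rewrite cos0 subrr.
  by move=> y; apply: is_derive_eq; rewrite subr0.
move: x; apply: is_derive_bound_pow d2; last by rewrite sin0 subrr.
Qed.

Lemma cos_taylor x : `|x| <= 1 -> `|cos x - 1 + x ^+ 2 / 2| <= 1 * `|x| ^+ 3.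
Proof.
have d2 (y : R) : `|y| <= 1 -> `|- (sin y - y)| <= 1 * `|y| ^+ 2.
  move=> y1; rewrite normrN (le_trans (sin_taylor y1))// !mul1r.
  by rewrite exprSr ler_piMr// exprn_ge0.
move: x; apply: is_derive_bound_pow d2; last by rewrite cos0; ring.
move=> y; apply: is_derive_eq; by rewrite /GRing.scale/=; field.
Qed.

End RealTaylor.

Section ComplexExponential.
Variable R : realType.
Local Notation C := (CC R).
Implicit Types z w h : C.

Lemma cexp0 : cexp (0 : C) = 1.
Proof. by apply/eqP; rewrite eq_complex /= expR0 cos0 sin0 !mul1r !eqxx. Qed.

Lemma cexpD z w : cexp (z + w) = cexp z * cexp w.
Proof.
case: z w => [a b] [c d]; rewrite /cexp; apply/eqP; rewrite eq_complex /=.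
rewrite expRD sinD cosD; apply/andP; split; apply/eqP; ring.
Qed.

Lemma cmod_cexp z : cmod (cexp z) = expR (complex.Re z).
Proof.
rewrite /cexp cmodE !exprMn -mulrDr cos2Dsin2 mulr1 sqrtr_sqr ger0_norm// expR_ge0.
Qed.

Lemma cexp_neq0 z : cexp z != 0.
Proof. by rewrite -cmod_gt0 cmod_cexp expR_gt0. Qed.

(** The third order matters: it makes [(e^w - 1) / w] differentiable at [0]. *)
Lemma cexp_taylor2 : exists2 M : R, 0 <= M & forall h, cmod h <= 1 ->
  cmod (cexp h - 1 - h - h ^+ 2 / 2) <= M * cmod h ^+ 3.
Proof.
exists (2 * expR 1 + 7); first by rewrite addr_ge0// mulr_ge0// expR_ge0.
move=> h; set r := cmod h => r1.
have r0 : 0 <= r by exact: cmod_ge0.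
have ar : `|complex.Re h| <= r by exact: Re_le_cmod.
have br : `|complex.Im h| <= r by exact: Im_le_cmod.
have [[t1 t2] t3] := (expR_taylor2 (le_trans ar r1),
  sin_taylor (le_trans br r1), cos_taylor (le_trans br r1)).
move: ar br t1 t2 t3; clearbody r; case: h => a b ar br.
have cu (t : R) : `|t| <= r -> `|t| ^+ 3 <= r ^+ 3 by move=> tr; rewrite lerXn2r// nnegrE.
set al := expR a - _ - _ - _; set ga := sin b - b; set be := cos b - 1 + _.
rewrite !mul1r => t1 t2 t3.
have {}t1 : `|al| <= expR 1 * r ^+ 3.
  by rewrite (le_trans t1)// ler_wpM2l ?expR_ge0// cu.
have {}t2 : `|ga| <= r ^+ 3 by rewrite (le_trans t2)// cu.
have {}t3 : `|be| <= r ^+ 3 by rewrite (le_trans t3)// cu.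
(* With [al], [be], [ga] the remainders of [exp a], [cos b], [sin b], the real
   and imaginary parts of the remainder are of third order term by term. *)
have -> : cexp (Complex a b : C) - 1 - Complex a b - (Complex a b : C) ^+ 2 / 2 =
    Complex (al * cos b + (1 + a + a ^+ 2 / 2) * be - (a + a ^+ 2 / 2) * (b ^+ 2 / 2))
      (al * sin b + (1 + a + a ^+ 2 / 2) * ga + a ^+ 2 / 2 * b).
  rewrite /cexp /al /ga /be; apply/eqP; rewrite eq_complex /=.
  by apply/andP; split; apply/eqP; field.
rewrite (le_trans (cmod_le_ReIm _ _))//.
have cos1 : `|cos b| <= 1 by rewrite ler_norml cos_geN1 cos_le1.
have sin1 : `|sin b| <= 1 by rewrite ler_norml sin_geN1 sin_le1.
have a1 : `|a| <= 1 by exact: le_trans ar r1.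
have rr : `|a ^+ 2| <= r ^+ 2 by rewrite normrX lerXn2r// nnegrE.
have bb : `|b ^+ 2| <= r ^+ 2 by rewrite normrX lerXn2r// nnegrE.
have r21 : r ^+ 2 <= 1 by rewrite expr_le1.
have r32 : r ^+ 3 <= r ^+ 2 by rewrite exprSr ler_piMr// exprn_ge0.
have a2r : `|a ^+ 2 / 2| <= r ^+ 2 / 2 by rewrite normrM (@ger0_norm _ 2^-1) ?ler_wpM2r.
have s1 : `|1 + a + a ^+ 2 / 2| <= 5 / 2.
  rewrite (le_trans (ler_normD _ _))// (le_trans (lerD (ler_normD _ _) a2r))//.
  rewrite normr1; lra.
have s2 : `|a + a ^+ 2 / 2| <= 3 / 2 * r.
  rewrite (le_trans (ler_normD _ _))// (le_trans (lerD ar a2r))//.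
  have : r ^+ 2 <= r by rewrite expr2 ler_piMr.
  lra.
have r30 : 0 <= r ^+ 3 by rewrite exprn_ge0.
have p1 : `|al * cos b| <= expR 1 * r ^+ 3.
  by rewrite normrM (le_trans _ t1)// ler_piMr.
have p1' : `|al * sin b| <= expR 1 * r ^+ 3.
  by rewrite normrM (le_trans _ t1)// ler_piMr.
have p2 : `|(1 + a + a ^+ 2 / 2) * be| <= 5 / 2 * r ^+ 3.
  by rewrite normrM ler_pM.
have p2' : `|(1 + a + a ^+ 2 / 2) * ga| <= 5 / 2 * r ^+ 3.
  by rewrite normrM ler_pM.
have p3 : `|(a + a ^+ 2 / 2) * (b ^+ 2 / 2)| <= 3 / 4 * r ^+ 3.
  have -> : 3 / 4 * r ^+ 3 = 3 / 2 * r * (r ^+ 2 / 2) by field.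
  by rewrite normrM ler_pM// normrM (@ger0_norm _ 2^-1) ?ler_wpM2r.
have p3' : `|a ^+ 2 / 2 * b| <= 1 / 2 * r ^+ 3.
  have -> : 1 / 2 * r ^+ 3 = r ^+ 2 / 2 * r by field.
  by rewrite normrM ler_pM.
have -> : (2 * expR 1 + 7) * r ^+ 3 = 2 * (expR 1 * r ^+ 3) + 7 * r ^+ 3 by ring.
apply: (le_trans (lerD (le_trans (ler_normB _ _) (lerD (ler_normD _ _) (lexx _)))
  (le_trans (ler_normD _ _) (lerD (ler_normD _ _) (lexx _))))).
lra.
Qed.

Lemma cmod_half : cmod (2^-1 : C) = 2^-1.
Proof.
have -> : (2^-1 : C) = real_complex R 2^-1 by rewrite fmorphV rmorph_nat.
by rewrite cmodE expr0n/= addr0 sqrtr_sqr ger0_norm.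
Qed.

Lemma entire_cexp : entire (@cexp R).
Proof.
move=> z; apply/differentiable_cmodP; exists (cexp z) => e e0.
have [M M0 HM] := cexp_taylor2.
have K0 : 0 < cmod (cexp z) * (M + 1) by rewrite mulr_gt0 ?cmod_gt0 ?cexp_neq0 ?ltr_wpDl.
pose d := Num.min 1 (e / (cmod (cexp z) * (M + 1))).
exists d; first by rewrite lt_min ltr01 divr_gt0.
move=> h; rewrite lt_min => /andP[h1 he].
have h0 := cmod_ge0 h.
have -> : cexp (h + z) - cexp z - cexp z * h =
   cexp z * ((cexp h - 1 - h - h ^+ 2 / 2) + h ^+ 2 / 2).
  by rewrite cexpD; field.
rewrite cmodM.
have A : cmod (cexp h - 1 - h - h ^+ 2 / 2 + h ^+ 2 / 2) <= (M + 1) * cmod h ^+ 2.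
  rewrite (le_trans (cmodD _ _))// (le_trans (lerD (HM _ (ltW h1)) (lexx _)))//.
  rewrite cmodM cmodX cmod_half mulrDl mul1r lerD//.
    by rewrite ler_wpM2l// exprSr ler_piMr ?exprn_ge0// ltW.
  by rewrite ler_piMr ?exprn_ge0// invf_le1// ler1n.
rewrite (le_trans (ler_wpM2l (cmod_ge0 _) A))// expr2 !mulrA ler_wpM2r//.
by rewrite -ler_pdivlMl// mulrC ltW.
Qed.

(** It turns the quotient by [x] in an overshear into a formula without
    division. *)
Definition cexpm1 w : C := if w == 0 then 1 else (cexp w - 1) / w.

Lemma cexp_expm1 w : cexp w = 1 + w * cexpm1 w.
Proof.
rewrite /cexpm1; have [->|w0] := eqVneq w 0; first by rewrite mul0r addr0 cexp0.
by rewrite mulrCA divff// mulr1 addrC subrK.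
Qed.

Lemma cexpm1_0 : cexpm1 0 = 1.
Proof. by rewrite /cexpm1 eqxx. Qed.

Lemma entire_cexpm1 : entire cexpm1.
Proof.
move=> z; have [->|z0] := eqVneq z 0; last first.
  have D : differentiable (fun w : C => (cexp w - 1) / w) z.
    apply: differentiableM; last by apply: differentiableV => //.
    apply: differentiableB => //; exact: entire_cexp.
  move/differentiable_cmodP : D => [D HD]; apply/differentiable_cmodP; exists D => e e0.
  have [d d0 Hd] := HD e e0.
  exists (Num.min d (cmod z)); first by rewrite lt_min d0 cmod_gt0.
  move=> h; rewrite lt_min => /andP[/Hd {}Hd hz].
  rewrite /cexpm1 (negbTE z0); case: eqP Hd => // /eqP hz0.
  by move: hz; rewrite addr_eq0 in hz0; rewrite (eqP hz0) cmodN ltxx.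
apply/differentiable_cmodP; exists 2^-1 => e e0.
have [M M0 HM] := cexp_taylor2.
exists (Num.min 1 (e / (M + 1))); first by rewrite lt_min ltr01 divr_gt0 ?ltr_wpDl.
move=> h; rewrite lt_min => /andP[h1 he]; rewrite addr0 cexpm1_0.
have [->|h0] := eqVneq h 0.
  by rewrite cexpm1_0 mulr0 subr0 subrr cmod0 mulr0.
rewrite /cexpm1 (negbTE h0).
have -> : (cexp h - 1) / h - 1 - 2^-1 * h = (cexp h - 1 - h - h ^+ 2 / 2) / h.
  by field.
rewrite cmodM cmodV ler_pdivrMr ?cmod_gt0//.
rewrite (le_trans (HM _ (ltW h1)))// -mulrA -expr2 exprSr mulrA mulrAC.
rewrite ler_wpM2r ?exprn_ge0 ?cmod_ge0// (@le_trans _ _ ((M + 1) * cmod h))//.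
  by rewrite ler_wpM2r ?cmod_ge0// lerDl.
by rewrite mulrC -ler_pdivlMr ?ltr_wpDl// ltW.
Qed.

End ComplexExponential.

(** * Goursat's theorem for closed differential forms *)

Section IntervalIntegral.
Variable R : realType.
Implicit Types (f g : R -> R) (a b c e k l : R).

Definition itv_int f a b : R := \int[@lebesgue_measure R]_(x in `[a, b]) f x.

Lemma continuous_itv_integrable f a b : continuous f ->
  (@lebesgue_measure R).-integrable `[a, b] (EFin \o f).
Proof.
move=> cf; apply: continuous_compact_integrable; first exact: segment_compact.
exact: continuous_subspaceT.
Qed.

Lemma itv_intD f a b c : continuous f -> a <= b -> b <= c ->
  itv_int f a c = itv_int f a b + itv_int f b c.
Proof.
move=> cf ab bc; have := @Rintegral_itvB R f (BLeft a) (BRight c) b.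
rewrite !bnd_simp => /(_ (continuous_itv_integrable _ _ cf) ab bc) e.
rewrite {3}/itv_int; have <- := @Rintegral_itv_obnd_cbnd R b (BRight c) f; last first.
  apply: integrableS (continuous_itv_integrable b c cf) => //.
  by apply: subset_itvr; rewrite bnd_simp.
by rewrite /itv_int -e addrC subrK.
Qed.

Lemma le_itv_int f g a b : continuous f -> continuous g ->
  (forall x, a <= x <= b -> f x <= g x) -> itv_int f a b <= itv_int g a b.
Proof.
move=> cf cg fg; apply: le_Rintegral => //; try exact: continuous_itv_integrable.
Qed.

Lemma continuous_affine k l : continuous (fun x : R => k + l * x).
Proof.
move=> x; apply: cvgD; first exact: cvg_cst.
by apply: cvgM; [exact: cvg_cst|exact: cvg_id].
Qed.

Lemma itv_int_affine k l a b : a <= b ->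
  itv_int (fun x => k + l * x) a b = k * (b - a) + l * (b ^+ 2 - a ^+ 2) / 2.
Proof.
rewrite le_eqVlt => /predU1P[<-|ab].
  by rewrite /itv_int set_itv1 Rintegral_set1 !subrr !mulr0 mul0r addr0.
pose F x := k * x + l / 2 * x ^+ 2.
have dF x : is_derive x (1 : R) F (k + l * x).
  by apply: is_derive_eq; rewrite /GRing.scale/=; field.
rewrite /itv_int /Rintegral (@continuous_FTC2 _ _ F)//.
- by rewrite /F /=; field.
- by apply: continuous_subspaceT; exact: continuous_affine.
- have cF : continuous F.
    by move=> x; apply: differentiable_continuous; apply/derivable1_diffP.
  split; first by move=> x _; case: (dF x).
    exact: cvg_at_right_filter (cF a).
  exact: cvg_at_left_filter (cF b).
- by move=> x _; rewrite derive1E; case: (dF x).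
Qed.

Lemma itv_int_near_affine f k l e a b : continuous f -> a <= b ->
  (forall x, a <= x <= b -> `|f x - (k + l * x)| <= e) ->
  `|itv_int f a b - (k * (b - a) + l * (b ^+ 2 - a ^+ 2) / 2)| <= e * (b - a).
Proof.
move=> cf ab fe; rewrite ler_distl.
have -> : k * (b - a) + l * (b ^+ 2 - a ^+ 2) / 2 + e * (b - a) =
  itv_int (fun x => (k + e) + l * x) a b by rewrite itv_int_affine//; ring.
have -> : k * (b - a) + l * (b ^+ 2 - a ^+ 2) / 2 - e * (b - a) =
  itv_int (fun x => (k - e) + l * x) a b by rewrite itv_int_affine//; ring.
have fe' x : a <= x <= b -> k - e + l * x <= f x <= k + e + l * x.
  by move=> /fe; rewrite ler_distl; lra.
apply/andP; split; apply: le_itv_int => //; try exact: continuous_affine;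
  by move=> x /fe' /andP[].
Qed.

End IntervalIntegral.

Section ClosedForms.
Variable R : realType.
Implicit Types (P Q : R -> R -> R).

Lemma nested_segments (l u : nat -> R) :
  (forall n, l n <= l n.+1) -> (forall n, u n.+1 <= u n) ->
  (forall n, l n <= u n) -> exists x, forall n, l n <= x <= u n.
Proof.
move=> lS uS lu.
have ln m n : (m <= n)%N -> l m <= l n by exact: (@homo_leq _ _ (<=%R) lexx le_trans).
have un m n : (m <= n)%N -> u n <= u m.
  by apply: (@homo_leq _ _ (fun x y => y <= x)) => // x y z yx zx; exact: le_trans zx yx.
have lun m n : l m <= u n.
  rewrite (le_trans (ln _ _ (leq_maxl m n)))// (le_trans (lu _))//.
  exact: un (leq_maxr _ _).
exists (sup (range l)) => n; apply/andP; split.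
  by apply: ub_le_sup; [exists (u 0%N) => _ [m _ <-]|exists n].
by apply: ge_sup; [exists (l 0%N), 0%N|move=> _ [m _ <-]].
Qed.

(** Differentiability of the form [P dx + Q dy] at a point, with symmetric
    Jacobian: the shared coefficient [b] says that its exterior derivative
    vanishes there. *)
Definition closed_at P Q (x0 y0 : R) := exists a b c : R,
  forall e, 0 < e -> exists2 d, 0 < d & forall x y,
  `|x - x0| < d -> `|y - y0| < d ->
  `|P x y - (P x0 y0 + a * (x - x0) + b * (y - y0))| <= e * (`|x - x0| + `|y - y0|) /\
  `|Q x y - (Q x0 y0 + b * (x - x0) + c * (y - y0))| <= e * (`|x - x0| + `|y - y0|).

(** The integral of [P dx + Q dy] along the boundary of a rectangle. *)
Definition rect_int P Q (a b c d : R) : R :=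
  itv_int (P^~ c) a b + itv_int (Q b) c d - itv_int (P^~ d) a b - itv_int (Q a) c d.

Section Goursat.
Variables P Q : R -> R -> R.
Hypothesis cP : forall y, continuous (P^~ y).
Hypothesis cQ : forall x, continuous (Q x).
Hypothesis PQ : forall x y, closed_at P Q x y.

Lemma rect_intD1 a b b' c d : a <= b -> b <= b' ->
  rect_int P Q a b' c d = rect_int P Q a b c d + rect_int P Q b b' c d.
Proof. by move=> ab bb'; rewrite /rect_int !(@itv_intD _ _ a b b')//; ring. Qed.

Lemma rect_intD2 a b c d d' : c <= d -> d <= d' ->
  rect_int P Q a b c d' = rect_int P Q a b c d + rect_int P Q a b d d'.
Proof. by move=> ab bb'; rewrite /rect_int !(@itv_intD _ _ c d d')//; ring. Qed.

Lemma rect_int_quad (x y A B : R) : 0 <= A -> 0 <= B ->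
  rect_int P Q x (x + (A + A)) y (y + (B + B)) =
  rect_int P Q x (x + A) y (y + B) + rect_int P Q x (x + A) (y + B) (y + B + B) +
  (rect_int P Q (x + A) (x + A + A) y (y + B) +
   rect_int P Q (x + A) (x + A + A) (y + B) (y + B + B)).
Proof.
move=> A0 B0; rewrite !addrA (@rect_intD1 x (x + A) (x + A + A)) ?lerDl//.
rewrite (@rect_intD2 x (x + A) y (y + B)) ?lerDl//.
by rewrite (@rect_intD2 (x + A) _ y (y + B)) ?lerDl// !addrA.
Qed.

(** Near a point the form is affine up to [o(h)], affine closed forms have zero
    boundary integral, so small rectangles of size [h] contribute [o(h^2)]. *)
Lemma rect_int_small x0 y0 e : 0 < e -> exists2 d, 0 < d &
  forall a b A B, 0 <= A < d -> 0 <= B < d ->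
    a <= x0 <= a + A -> b <= y0 <= b + B ->
    `|rect_int P Q a (a + A) b (b + B)| <= e * (A + B) ^+ 2.
Proof.
move=> e0; have [al [be [ga H]]] := PQ x0 y0.
have [d d0 {}H] := H (e / 2) (divr_gt0 e0 (ltr0n R 2)).
exists d => // a b A B /andP[A0 Ad] /andP[B0 Bd] xa yb.
have HP x y : a <= x <= a + A -> b <= y <= b + B ->
    `|P x y - (P x0 y0 - al * x0 - be * y0 + be * y + al * x)| <= e / 2 * (A + B) /\
    `|Q x y - (Q x0 y0 - be * x0 - ga * y0 + be * x + ga * y)| <= e / 2 * (A + B).
  move=> xA yB.
  have dx : `|x - x0| <= A by rewrite ler_norml; lra.
  have dy : `|y - y0| <= B by rewrite ler_norml; lra.
  have [h1 h2] := H x y (le_lt_trans dx Ad) (le_lt_trans dy Bd).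
  have h3 : e / 2 * (`|x - x0| + `|y - y0|) <= e / 2 * (A + B).
    by rewrite ler_wpM2l ?divr_ge0 ?(ltW e0)// lerD.
  split.
    by apply: le_trans h3; apply: le_trans h1; rewrite le_eqVlt; apply/orP; left;
      apply/eqP; congr `|_|; ring.
  by apply: le_trans h3; apply: le_trans h2; rewrite le_eqVlt; apply/orP; left;
    apply/eqP; congr `|_|; ring.
have [aA bB] : a <= a + A /\ b <= b + B by rewrite !lerDl.
have i1 := @itv_int_near_affine R (P^~ b) _ _ _ _ _ (@cP b) aA
  (fun x xA => (HP x b xA ltac:(lra)).1).
have i2 := @itv_int_near_affine R (P^~ (b + B)) _ _ _ _ _ (@cP (b + B)) aA
  (fun x xA => (HP x (b + B) xA ltac:(lra)).1).
have i3 := @itv_int_near_affine R (Q a) _ _ _ _ _ (@cQ a) bB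
  (fun y yB => (HP a y ltac:(lra) yB).2).
have i4 := @itv_int_near_affine R (Q (a + A)) _ _ _ _ _ (@cQ (a + A)) bB
  (fun y yB => (HP (a + A) y ltac:(lra) yB).2).
rewrite /rect_int; move: i1 i2 i3 i4.
move: (itv_int _ _ _) (itv_int _ _ _) (itv_int _ _ _) (itv_int _ _ _) => I1 I2 I3 I4.
rewrite !ler_norml => /andP[p1 p2] /andP[q1 q2] /andP[r1 r2] /andP[s1 s2].
have E : e * (A + B) ^+ 2 = 2 * (e / 2 * (A + B) * A) + 2 * (e / 2 * (A + B) * B) by field.
rewrite E; apply/andP; split.
  move: p1 p2 q1 q2 r1 r2 s1 s2.
  rewrite (_ : a + A - a = A); last by ring.
  rewrite (_ : b + B - b = B); last by ring.
  lra.
move: p1 p2 q1 q2 r1 r2 s1 s2.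
rewrite (_ : a + A - a = A); last by ring.
rewrite (_ : b + B - b = B); last by ring.
lra.
Qed.


(** Goursat's bisection.  One of the four quarters of a rectangle carries at
    least a quarter of its boundary integral; the nested rectangles so chosen
    shrink to a point, where [rect_int_small] bounds the integral by an
    arbitrarily small multiple of the area. *)
Lemma rect_int_eq0 (a b A B : R) : 0 <= A -> 0 <= B ->
  rect_int P Q a (a + A) b (b + B) = 0.
Proof.
move=> A0 B0; pose h n : R := 2^-1 ^+ n.
have h0 n : 0 <= h n by rewrite exprn_ge0.
have hS n : h n = h n.+1 + h n.+1 by rewrite /h exprS; field.
pose G n (v : R * R) := `|rect_int P Q v.1 (v.1 + A * h n) v.2 (v.2 + B * h n)|.
have /choice[nx Hnx] (nv : nat * (R * R)) : exists w : R * R,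
    [/\ nv.2.1 <= w.1, w.1 + A * h nv.1.+1 <= nv.2.1 + A * h nv.1,
        nv.2.2 <= w.2, w.2 + B * h nv.1.+1 <= nv.2.2 + B * h nv.1 &
        G nv.1 nv.2 <= 4 * G nv.1.+1 w].
  case: nv => n [x y] /=.
  have Ah : 0 <= A * h n.+1 by rewrite mulr_ge0.
  have Bh : 0 <= B * h n.+1 by rewrite mulr_ge0.
  pose w i j : R * R := (x + i%:R * (A * h n.+1), y + j%:R * (B * h n.+1)).
  have G4 : G n (x, y) <= G n.+1 (w 0 0)%N + G n.+1 (w 0 1)%N
      + (G n.+1 (w 1 0)%N + G n.+1 (w 1 1)%N).
    rewrite /G /= !mul0r !addr0 !mul1r.
    rewrite (hS n) !mulrDr rect_int_quad//.
    by rewrite (le_trans (ler_normD _ _))// lerD// ler_normD.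
  have wP i j : (i <= 1)%N -> (j <= 1)%N -> G n (x, y) <= 4 * G n.+1 (w i j) ->
      exists w : R * R,
      [/\ x <= w.1, w.1 + A * h n.+1 <= x + A * h n,
        y <= w.2, w.2 + B * h n.+1 <= y + B * h n &
        G n (x, y) <= 4 * G n.+1 w].
    move=> i1 j1 Gw; exists (w i j); split => //=.
    - by rewrite lerDl mulr_ge0// ler0n.
    - by rewrite (hS n) mulrDr addrA lerD2r lerD2l ler_piMl// (ler_nat R i 1).
    - by rewrite lerDl mulr_ge0// ler0n.
    - by rewrite (hS n) mulrDr addrA lerD2r lerD2l ler_piMl// (ler_nat R j 1).
  have [g|g00] := leP (G n (x, y)) (4 * G n.+1 (w 0 0)%N); first exact: wP g.
  have [g|g01] := leP (G n (x, y)) (4 * G n.+1 (w 0 1)%N); first exact: wP g.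
  have [g|g10] := leP (G n (x, y)) (4 * G n.+1 (w 1 0)%N); first exact: wP g.
  by apply: (wP 1 1)%N => //; lra.
pose s := fix s n : R * R := if n is m.+1 then nx (m, s m) else (a, b).
have sP n := Hnx (n, s n).
have [x0 Hx0] : exists x, forall n, (s n).1 <= x <= (s n).1 + A * h n.
  apply: nested_segments => n; try by case: (sP n).
  by rewrite lerDl mulr_ge0.
have [y0 Hy0] : exists x, forall n, (s n).2 <= x <= (s n).2 + B * h n.
  apply: nested_segments => n; try by case: (sP n).
  by rewrite lerDl mulr_ge0.
have Gs n : G 0%N (a, b) <= 4 ^+ n * G n (s n).
  elim: n => [|n IH]; first by rewrite expr0 mul1r.
  rewrite (le_trans IH)// exprSr -mulrA ler_wpM2l ?exprn_ge0//.
  by case: (sP n).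
suff : G 0%N (a, b) = 0 by rewrite /G /h expr0 !mulr1 => /eqP; rewrite normr_eq0 => /eqP.
apply/eqP; rewrite eq_le normr_ge0 andbT; apply/ler_addgt0Pr => e0 e00; rewrite add0r.
have AB0 : 0 < (A + B) ^+ 2 + 1 by rewrite ltr_wpDl ?sqr_ge0.
pose e := e0 / ((A + B) ^+ 2 + 1).
have e_gt0 : 0 < e by rewrite divr_gt0.
have [d d0 Hd] := rect_int_small x0 y0 e_gt0.
have [n nd] : exists n, (A + B) * h n < d.
  exists (Num.bound ((A + B) / d)).
  have := archi_boundP (divr_ge0 (addr_ge0 A0 B0) (ltW d0)).
  set n := Num.bound _ => nP.
  rewrite /h exprVn ltr_pdivrMr ?exprn_gt0// mulrC -ltr_pdivrMr//.
  rewrite (lt_le_trans nP)// -natrX ler_nat ltnW// ltn_expl//.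
have := Hd (s n).1 (s n).2 (A * h n) (B * h n).
move: nd; rewrite mulrDl => nd; have Ah : 0 <= A * h n by rewrite mulr_ge0.
have Bh : 0 <= B * h n by rewrite mulr_ge0.
rewrite Ah Bh (_ : A * h n < d); last by lra.
rewrite (_ : B * h n < d); last by lra.
move=> /(_ isT isT (Hx0 n) (Hy0 n)) Gn.
rewrite (le_trans (Gs n))// (@le_trans _ _ (4 ^+ n * (e * (A * h n + B * h n) ^+ 2)))//.
  by rewrite ler_wpM2l// exprn_ge0.
have -> : 4 ^+ n * (e * (A * h n + B * h n) ^+ 2) = e * (A + B) ^+ 2.
  rewrite -mulrDl exprMn mulrCA (mulrC (_ ^+ 2) (_ ^+ 2)) [4 ^+ n * _]mulrA.
  rewrite /h -exprM mulnC exprM -exprMn (_ : 4 * 2^-1 ^+ 2 = 1); last by field.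
  by rewrite expr1n mul1r.
by rewrite /e mulrAC ler_pdivrMr// ler_wpM2l ?(ltW e00)// lerDl.
Qed.

End Goursat.
End ClosedForms.

(** * The maximum principle *)

Section MaximumPrinciple.
Variable R : realType.
Local Notation C := (CC R).
Implicit Types (F : C -> C) (x y rho theta B : R).

(** Circles are parametrized by the logarithm [rho] of their radius, so that
    the whole plane minus [0] becomes a periodic strip. *)
Definition polar rho theta : C := cexp (Complex rho theta).

Lemma cmod_polar rho theta : cmod (polar rho theta) = expR rho.
Proof. exact: cmod_cexp. Qed.

Lemma polarD rho theta x : polar rho (theta + x) = polar rho theta * polar 0 x.
Proof.
rewrite /polar -cexpD; congr cexp.
by apply/eqP; rewrite eq_complex /= addr0 !eqxx.
Qed.

Lemma polar_2pi rho : polar rho (2 * pi) = polar rho 0.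
Proof.
rewrite /polar /cexp /= mulr_natl -[pi *+ 2]add0r.
by rewrite cosD2pi sinD2pi.
Qed.

Lemma continuous_Re_polar F : entire F ->
  (forall x, continuous (fun y => complex.Re (F (polar x y)))) /\
  (forall y, continuous (fun x => complex.Im (F (polar x y)))).
Proof.
move=> eF.
have cF x y : {for Complex x y : C, continuous (F \o @cexp R)}.
  apply: differentiable_continuous; apply: differentiable_comp.
    exact: entire_cexp.
  exact: eF.
split=> [x y|y x]; apply/cvgrPdist_lt => e e0;
  have /continuous_cmodP/(_ e e0)[d d0 Hd] := cF x y; near=> t.
- rewrite -ReB (le_lt_trans (Re_le_cmod _))// cmodC; apply: (Hd (Complex x t)).
  rewrite (_ : (Complex x t : C) - Complex x y = Complex (x - x) (t - y))//.
  rewrite (le_lt_trans (cmod_le_ReIm _ _))// subrr normr0 add0r distrC.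
  by near: t; exact: cvgr_dist_lt.
- rewrite -ImB (le_lt_trans (Im_le_cmod _))// cmodC; apply: (Hd (Complex t y)).
  rewrite (_ : (Complex t y : C) - Complex x y = Complex (t - x) (y - y))//.
  rewrite (le_lt_trans (cmod_le_ReIm _ _))// subrr normr0 addr0 distrC.
  by near: t; exact: cvgr_dist_lt.
Unshelve. all: by end_near. Qed.

(** In the coordinate [zeta = rho + i theta] the form is the imaginary part of
    [F(e^zeta) d zeta], and the Cauchy-Riemann equations make it closed. *)
Lemma closed_at_polar F x y : entire F ->
  closed_at (fun x y => complex.Im (F (polar x y)))
            (fun x y => complex.Re (F (polar x y))) x y.
Proof.
move=> eF.
have /differentiable_cmodP[D HD] : differentiable (F \o @cexp R) (Complex x y : C).
  by apply: differentiable_comp; [exact: entire_cexp|exact: eF].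
exists (complex.Im D), (complex.Re D), (- complex.Im D) => e e0.
have [d d0 {}HD] := HD e e0.
exists (d / 2); first by rewrite divr_gt0.
move=> x' y' dx dy.
have hd : cmod (Complex (x' - x) (y' - y) : C) <= `|x' - x| + `|y' - y|.
  exact: cmod_le_ReIm.
have := HD (Complex (x' - x) (y' - y)); have -> /= : (Complex (x' - x) (y' - y) : C) + Complex x y = Complex x' y'.
  by apply/eqP; rewrite eq_complex /= !subrK !eqxx.
have hd2 : cmod (Complex (x' - x) (y' - y) : C) < d by rewrite (le_lt_trans hd)//; lra.
move=> /(_ hd2) H.
rewrite -/(polar x y) -/(polar x' y') in H.
have {}H : cmod (F (polar x' y') - F (polar x y) - D * Complex (x' - x) (y' - y)) <=
    e * (`|x' - x| + `|y' - y|).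
  by rewrite (le_trans H)// ler_wpM2l// ltW.
split.
  apply: le_trans H; apply: le_trans (Im_le_cmod _).
  rewrite !ImB le_eqVlt; apply/orP; left; apply/eqP; congr `|_|.
  by case: D {HD} => D1 D2 /=; ring.
apply: le_trans H; apply: le_trans (Re_le_cmod _).
rewrite !ReB le_eqVlt; apply/orP; left; apply/eqP; congr `|_|.
by case: D {HD} => D1 D2 /=; ring.
Qed.

(** The two horizontal sides of the rectangle of height [2 pi] cancel by
    periodicity, so the mean of [Re F] over a circle does not depend on the
    radius. *)
Lemma itv_int_polar F rho rho' : entire F -> rho' <= rho ->
  itv_int (fun y => complex.Re (F (polar rho y))) 0 (2 * pi) =
  itv_int (fun y => complex.Re (F (polar rho' y))) 0 (2 * pi).
Proof.
move=> eF rr; have [cQ cP] := continuous_Re_polar eF.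
have rr0 : 0 <= rho - rho' by rewrite subr_ge0.
have pi2 : 0 <= 2 * (pi : R) by rewrite mulr_ge0 ?pi_ge0.
have := @rect_int_eq0 R (fun x y => complex.Im (F (polar x y))) (fun x y => complex.Re (F (polar x y))) cP cQ
  (fun x y => closed_at_polar x y eF) rho' 0 (rho - rho') (2 * pi) rr0 pi2.
rewrite add0r addrC subrK /rect_int.
rewrite (_ : (fun x => complex.Im (F (polar x (2 * pi)))) = (fun x => complex.Im (F (polar x 0)))).
  have cancel (a b c : R) : a + b - a - c = 0 -> b = c by lra.
  exact: cancel.
by apply/funext => x; rewrite polar_2pi.
Qed.

Lemma Re_max_principle F rho B : entire F ->
  (forall theta, 0 <= theta <= 2 * pi -> complex.Re (F (polar rho theta)) <= B) -> complex.Re (F 0) <= B.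
Proof.
move=> eF FB; rewrite leNgt; apply/negP => BF.
have /differentiable_continuous/continuous_cmodP cF := eF 0.
pose e := (complex.Re (F 0) - B) / 2.
have e0 : 0 < e by rewrite divr_gt0// subr_gt0.
have [d d0 Hd] := cF e e0.
(* On the circle of radius [expR rho' <= d / 2], [Re F] is close to [Re (F 0)]. *)
pose rho' := Num.min rho (ln (d / 2)).
have rr : rho' <= rho by rewrite ge_min lexx.
have := itv_int_polar eF rr; apply/eqP.
have [cQ _] := continuous_Re_polar eF.
have cstE (k : R) : itv_int (cst k) 0 (2 * pi) = k * (2 * pi).
  have := @itv_int_affine R k 0 0 (2 * pi); rewrite mulr_ge0 ?pi_ge0// => /(_ isT).
  rewrite mul0r mul0r addr0 subr0 => <-; congr itv_int.
  by apply/funext => x; rewrite mul0r addr0.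
have c (k : R) : continuous (cst k : R -> R) by move=> x; exact: cvg_cst.
have pi0 : 0 < 2 * (pi : R) by rewrite mulr_gt0// pi_gt0.
rewrite lt_eqF// (@le_lt_trans _ _ (B * (2 * pi)))//.
  by rewrite -cstE; apply: le_itv_int.
rewrite (@lt_le_trans _ _ ((B + e) * (2 * pi)))//.
  by rewrite ltr_pM2r// ltrDl.
rewrite -cstE; apply: le_itv_int => // y _ /=.
have : cmod (polar rho' y - 0) < d.
  rewrite subr0 cmod_polar (@le_lt_trans _ _ (d / 2))//; last first.
    by rewrite ltr_pdivrMr// ltr_pMr// ltr1n.
  rewrite -[leRHS]lnK ?posrE ?divr_gt0// ler_expR ge_min lexx orbT//.
move=> /Hd; have := Re_le_cmod (F (polar rho' y) - F 0).
rewrite ReB => h1 /(le_lt_trans h1); rewrite ltr_norml => /andP[h2 _].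
rewrite /e in h2 *; lra.
Qed.

(** After division by [F 0] the value at [0] is [1], whose real part is its
    modulus. *)
Lemma max_principle F rho B : entire F ->
  (forall theta, 0 <= theta <= 2 * pi -> cmod (F (polar rho theta)) <= B) -> cmod (F 0) <= B.
Proof.
move=> eF FB; have [->|F0] := eqVneq (F 0) 0.
  by rewrite cmod0 (le_trans (cmod_ge0 _) (FB 0 _))// lexx mulr_ge0// pi_ge0.
have eG : entire (fun z => F z * (F 0)^-1).
  by move=> z; apply: differentiableM => //; exact: differentiable_cst.
have := @Re_max_principle _ rho (B / cmod (F 0)) eG; rewrite divff//=.
rewrite ler_pdivlMr ?cmod_gt0// mul1r; apply=> y y2pi.
rewrite (le_trans (ler_norm _))// (le_trans (Re_le_cmod _))//.
by rewrite cmodM cmodV ler_pM2r ?invr_gt0 ?cmod_gt0// FB.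
Qed.

End MaximumPrinciple.

(** * Discrete means and Jensen's inequality *)

Lemma segment_unif_continuous (R : realType) (f : R -> R) (a b e : R) :
  continuous f -> 0 < e -> exists2 d : R, 0 < d &
    forall x y, a <= x <= b -> `|y - x| < d -> `|f y - f x| < e.
Proof.
move=> cf e0.
have /compact_near_coveringP/(_ _ (0 : R)^'+
    (fun d x => forall y, `|y - x| < d -> `|f y - f x| < e)) := @segment_compact R a b.
case.
  move=> x _; have e20 : 0 < e / 2 by rewrite divr_gt0.
  have /cvgrPdist_lt/(_ _ e20)/nbhs_normP[d /= d0 Hd] := cf x.
  have d20 : 0 < d / 2 by rewrite divr_gt0.
  exists (ball x (d / 2), [set t | 0 < t < d / 2]) => /=.
    split; first exact: nbhsx_ballx.
    near=> t; apply/andP; split; near: t; first exact: nbhs_right_gt.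
    exact: nbhs_right_lt.
  move=> [x' t] /= [xx' /andP[t0 td]] y yx'.
  have h1 : `|f x - f x'| < e / 2.
    by apply: Hd; rewrite /ball_/= (lt_trans xx')// ltr_pdivrMr// ltr_pMr// ltr1n.
  have h2 : `|f x - f y| < e / 2.
    apply: Hd; rewrite /ball_/=.
    have -> : x - y = (x - x') - (y - x') by ring.
    rewrite (le_lt_trans (ler_normB _ _))// [d]splitr ltrD// (lt_trans yx')//.
  have -> : f y - f x' = (f x - f x') - (f x - f y) by ring.
  by rewrite (le_lt_trans (ler_normB _ _))// [e]splitr ltrD.
move=> r /= r0 Hr; exists (r / 2); first by rewrite divr_gt0.
move=> x y xab yx; apply: (Hr (r / 2)) => //=.
- by rewrite sub0r normrN gtr0_norm ?divr_gt0// ltr_pdivrMr// ltr_pMr// ltr1n.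
- by rewrite divr_gt0.
Unshelve. all: by end_near. Qed.

Section DiscreteMeans.
Variable R : realType.
Local Notation C := (CC R).
Implicit Types (q : C -> C) (psi : C -> R) (rho : R) (N : nat).

(** The mean of [psi] over [N] equally spaced points of the circle of radius
    [expR rho]. *)
Definition cmean rho N psi : R :=
  N%:R^-1 * \sum_(k < N) psi (polar rho (k%:R * (2 * pi / N%:R))).

Lemma le_cmean rho N psi1 psi2 :
  (forall theta, 0 <= theta <= 2 * pi ->
    psi1 (polar rho theta) <= psi2 (polar rho theta)) ->
  cmean rho N psi1 <= cmean rho N psi2.
Proof.
move=> H; rewrite ler_wpM2l ?invr_ge0//; apply: ler_sum => k _; apply: H.
have N0 : 0 < N%:R :> R by rewrite ltr0n (leq_ltn_trans _ (ltn_ord k)).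
have pi2 : 0 <= 2 * (pi : R) by rewrite mulr_ge0 ?pi_ge0.
rewrite mulr_ge0 ?divr_ge0//= mulrCA ler_piMr// ler_pdivrMr// mul1r.
by rewrite ler_nat ltnW.
Qed.

Lemma cmeanD rho N psi1 psi2 :
  cmean rho N (fun t => psi1 t + psi2 t) = cmean rho N psi1 + cmean rho N psi2.
Proof. by rewrite /cmean big_split mulrDr. Qed.

Lemma cmeanB rho N psi1 psi2 :
  cmean rho N (fun t => psi1 t - psi2 t) = cmean rho N psi1 - cmean rho N psi2.
Proof. by rewrite /cmean sumrB mulrBr. Qed.

Lemma cmeanZ rho N c psi : cmean rho N (fun t => c * psi t) = c * cmean rho N psi.
Proof. by rewrite /cmean -mulr_sumr mulrCA. Qed.

Lemma cmean_cst rho N c : (0 < N)%N -> cmean rho N (fun=> c) = c.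
Proof.
move=> N0; rewrite /cmean sumr_const card_ord -[c *+ N]mulr_natl mulrA.
by rewrite mulVf ?mul1r// pnatr_eq0 -lt0n.
Qed.

Lemma continuous_cmod_polar q rho : entire q ->
  continuous (fun theta => cmod (q (polar rho theta))).
Proof.
move=> eq x; apply/cvgrPdist_lt => e e0.
have /continuous_cmodP/(_ e e0)[d d0 Hd] : {for Complex rho x : C, continuous (q \o @cexp R)}.
  apply: differentiable_continuous; apply: differentiable_comp.
    exact: entire_cexp.
  exact: eq.
near=> t; rewrite (@le_lt_trans _ _ (cmod (q (polar rho x) - q (polar rho t))))//.
  rewrite ler_norml lerBlDr lerBrDr cmod_leD andbT.
  by rewrite addrC lerBlDr addrC cmodC cmod_leD.
rewrite cmodC; apply: (Hd (Complex rho t)).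
rewrite (_ : (Complex rho t : C) - Complex rho x = Complex (rho - rho) (t - x))//.
rewrite (le_lt_trans (cmod_le_ReIm _ _))// subrr normr0 add0r distrC.
by near: t; exact: cvgr_dist_lt.
Unshelve. all: by end_near. Qed.

Lemma continuous_ln_max (f : R -> R) eps : 0 < eps -> continuous f ->
  continuous (fun x => ln (Num.max (f x) eps)).
Proof.
move=> eps0 cf x; apply: continuous_comp.
  by apply: continuous_max; [exact: cf|exact: cvg_cst].
by apply: continuous_ln; rewrite lt_max eps0 orbT.
Qed.

Lemma periodic_sum_shift (f : R -> R) N h : (forall x, f (x + N%:R * h) = f x) ->
  forall j x, \sum_(k < N) f (x + j%:R * h + k%:R * h) = \sum_(k < N) f (x + k%:R * h).
Proof.
move=> fN; elim=> [|j IH] x; first by rewrite mul0r addr0.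
rewrite -[RHS]IH {IH}; set y := x + j%:R * h.
have -> : x + j.+1%:R * h = y + h by rewrite /y -addrA -natr1 mulrDl mul1r.
apply: (@addIr _ (f (y + 0%:R * h))).
transitivity (\sum_(k < N.+1) f (y + k%:R * h)).
  rewrite big_ord_recl /= addrC; congr (_ + _).
  by apply: eq_bigr => k _; rewrite /bump /= add1n -natr1 mulrDl mul1r [_ * h + h]addrC addrA.
by rewrite big_ord_recr/= fN mul0r addr0.
Qed.

(** A discrete form of Jensen's inequality.  The product of the [N] rotations
    of [q] by [N]-th roots of unity takes the value [q 0 ^+ N] at [0], and its
    modulus on the circle is nearly constant when [N] is large, so the maximum
    principle bounds [ln |q 0|] by the mean of [ln |q|].  Truncating at [eps]
    makes the logarithm continuous. *)
Lemma jensen q rho eps eta : entire q -> q 0 != 0 -> 0 < eps -> 0 < eta ->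
  \forall N \near \oo,
    ln (cmod (q 0)) <= cmean rho N (fun t => ln (Num.max (cmod (q t)) eps)) + eta.
Proof.
move=> eq q0 eps0 eta0.
pose f x := ln (Num.max (cmod (q (polar rho x))) eps).
have cf : continuous f.
  by apply: continuous_ln_max => //; exact: continuous_cmod_polar.
have pi0 : 0 < 2 * (pi : R) by rewrite mulr_gt0 ?pi_gt0.
have [d d0 Hd] := @segment_unif_continuous R f 0 (2 * pi) eta cf eta0.
near=> N.
have N0 : (0 < N)%N by near: N; exists 1%N.
have NR0 : 0 < N%:R :> R by rewrite ltr0n.
pose h : R := 2 * pi / N%:R.
have h0 : 0 < h by rewrite divr_gt0.
have Nh : N%:R * h = 2 * pi by rewrite mulrC divfK// gt_eqF.
have hd : h < d.
  rewrite ltr_pdivrMr// -ltr_pdivrMl//.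
  by near: N; exact: nbhs_infty_gtr.
have fN x : f (x + N%:R * h) = f x.
  by rewrite /f polarD Nh polar_2pi -polarD addr0.
have S j x := periodic_sum_shift fN j x.
have Smax x : 0 <= x <= 2 * pi ->
    \sum_(k < N) f (x + k%:R * h) <= \sum_(k < N) f (k%:R * h) + N%:R * eta.
  move=> /andP[x0 _].
  (* The sum has period [h] in [x], so [x] may be reduced modulo [h]. *)
  pose j := Num.truncn (x / h).
  have [jx xj] : j%:R * h <= x /\ x < j%:R * h + h.
    have := Num.Theory.truncn_itv (divr_ge0 x0 (ltW h0)).
    by rewrite -/j ler_pdivlMr// ltr_pdivrMr// -natr1 mulrDl mul1r => /andP.
  rewrite (_ : x = x - j%:R * h + j%:R * h); last by rewrite subrK.
  have -> : N%:R * eta = \sum_(k < N) eta by rewrite sumr_const card_ord mulr_natl.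
  rewrite S -big_split/=.
  apply: ler_sum => k _.
  have : `|x - j%:R * h + k%:R * h - k%:R * h| < d.
    rewrite addrK ger0_norm ?subr_ge0//; lra.
  have kN : 0 <= k%:R * h <= 2 * pi.
    by rewrite mulr_ge0 ?(ltW h0)//= -Nh ler_pM2r// ler_nat ltnW.
  by move=> /(Hd _ _ kN); rewrite ltr_norml => /andP[_]; lra.
pose M t := \prod_(k < N) q (t * polar 0 (k%:R * h)).
have eM : entire M.
  apply: hol_prod => k; apply: (hol_comp eq).
  by apply: holM; [exact: hol_id|exact: hol_cst].
have M0 : cmod (M 0) = expR (N%:R * ln (cmod (q 0))).
  rewrite /M; under eq_bigr do rewrite mul0r.
  rewrite prodr_const card_ord cmodX mulr_natl -lnXn ?cmod_gt0//.
  by rewrite lnK// posrE exprn_gt0// cmod_gt0.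
have : cmod (M 0) <= expR (\sum_(k < N) f (k%:R * h) + N%:R * eta).
  apply: (@max_principle R M rho) => // x x2pi.
  rewrite (@le_trans _ _ (expR (\sum_(k < N) f (x + k%:R * h))))//; last first.
    by rewrite ler_expR Smax.
  rewrite /M cmod_prod expR_sum; apply: ler_prod => k _.
  rewrite cmod_ge0 -polarD /f lnK ?le_max ?lexx// posrE lt_max eps0 orbT//.
rewrite M0 ler_expR => H.
rewrite /cmean -(ler_pM2l NR0) mulrDr mulVKf ?gt_eqF//.
Unshelve. all: by end_near. Qed.

End DiscreteMeans.

(** * Bounds for entire functions and polynomials *)

Section Bounds.
Variable R : realType.
Local Notation C := (CC R).
Implicit Types (f : C -> C) (rho : R).

Lemma bounded_on_circle f rho : entire f -> exists2 B : R, 0 < B &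
  forall theta, 0 <= theta <= 2 * pi -> cmod (f (polar rho theta)) <= B.
Proof.
move=> ef; have cf := @continuous_cmod_polar R f rho ef.
have pi2 : 0 <= 2 * (pi : R) by rewrite mulr_ge0 ?pi_ge0.
have [c _ Hc] := EVT_max pi2 (continuous_subspaceT cf).
exists (cmod (f (polar rho c)) + 1); first by rewrite ltr_wpDl ?cmod_ge0.
move=> th th2; rewrite (le_trans (Hc th _)) ?in_itv//= lerDl//.
Qed.

Lemma bounded_on_disc f : entire f -> exists2 K : R, 1 <= K &
  forall t, cmod t <= 1 -> cmod (f t) <= K.
Proof.
move=> ef; pose g (x : R * R) := cmod (f (Complex x.1 x.2)).
pose S : set (R * R) := `[-1, 1]%classic `*` `[-1, 1]%classic.
have cS : compact S by apply: compact_setX; exact: segment_compact.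
have cg : continuous g.
  move=> x; apply/cvgrPdist_lt => e e0.
  have /continuous_cmodP/(_ e e0)[d d0 Hd] := @hol_continuous R _ _ f ef (Complex x.1 x.2).
  have d20 : 0 < d / 2 by rewrite divr_gt0.
  exists (ball x.1 (d / 2), ball x.2 (d / 2)) => /=.
    by split; exact: nbhsx_ballx.
  move=> [a b] [/= ha hb].
  have h : cmod (f (Complex a b) - f (Complex x.1 x.2)) < e.
    apply: Hd; rewrite (_ : (Complex a b : C) - Complex x.1 x.2 = Complex (a - x.1) (b - x.2))//.
    rewrite (le_lt_trans (cmod_le_ReIm _ _))// [d]splitr ltrD//.
      by rewrite distrC.
    by rewrite distrC.
  rewrite (le_lt_trans _ h)// /g /= ler_norml lerBlDr lerBrDr.
  rewrite cmodC cmod_leD andbT addrC lerBlDr addrC cmodC.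
  exact: cmod_leD.
have [|c _ Hc] := compact_EVT_max _ cS (continuous_subspaceT cg).
  by exists (0, 0); split; rewrite /= in_itv/= oppr_le0 ler01.
exists (g c + 1); first by rewrite lerDr cmod_ge0.
move=> [a b] t1; rewrite (@le_trans _ _ (g c)) ?lerDl//.
apply: (Hc (a, b)); rewrite inE; split; rewrite /= in_itv/= -ler_norml.
  exact: le_trans (Re_le_cmod (Complex a b)) t1.
exact: le_trans (Im_le_cmod (Complex a b)) t1.
Qed.

(** If [f] vanished near [t1], it could be divided by any power of [t - t1];
    the maximum principle on a circle around a non-zero [t0], most of whose
    points are further from [t1] than [t0] is, would give [f t0 = 0]. *)
Lemma identity_theorem f t0 t1 (d : R) : entire f -> f t0 != 0 -> 0 < d ->
  exists2 t, cmod (t - t1) < d & f t != 0.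
Proof.
move=> ef ft0 d0; apply: contrapT => nex.
have fd t : cmod (t - t1) < d -> f t = 0.
  move=> td; apply/eqP; apply/negP => /negP ft; apply: nex; by exists t.
have t01 : t0 - t1 != 0.
  apply: contra ft0 => /eqP e; apply/eqP; apply: fd; by rewrite e cmod0.
pose D := cmod (t0 - t1); have D0 : 0 < D by rewrite cmod_gt0.
pose G n t := f (t + t0) / (t + t0 - t1) ^+ n.
have eG n : entire (G n).
  move=> z; have [z1|z1] := eqVneq (z + t0 - t1) 0; last first.
    apply: differentiableM.
      apply: differentiable_comp; last exact: ef.
      exact: holD hol_id (hol_cst t0) z.
    apply: differentiableV; last by rewrite expf_neq0.
    exact: (holX n (holD (holD hol_id (hol_cst t0)) (hol_cst (- t1)))).
  apply/differentiable_cmodP; exists 0 => e e0; exists d => // h hd.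
  rewrite /G (fd (z + t0)) ?z1 ?cmod0//.
  rewrite fd; last by rewrite -!addrA (addrA z) z1 addr0.
  by rewrite !mul0r !subr0 cmod0 mulr_ge0 ?cmod_ge0// ltW.
have eft0 : entire (fun t => f (t + t0)).
  exact: (hol_comp ef (holD hol_id (hol_cst t0))).
(* Points at distance [3 D] from [t0] are at distance at least [2 D] from [t1]. *)
have [M M0 HM] := bounded_on_circle (ln (3 * D)) eft0.
have GM n : cmod (f t0) / D ^+ n <= M / (2 * D) ^+ n.
  have <- : cmod (G n 0) = cmod (f t0) / D ^+ n.
    by rewrite /G add0r cmodM cmodV cmodX.
  apply: (@max_principle R (G n) (ln (3 * D))) => // th th2.
  rewrite /G cmodM cmodV cmodX ler_pM ?cmod_ge0 ?invr_ge0 ?exprn_ge0 ?cmod_ge0//.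
    exact: HM.
  have D2 : 2 * D <= cmod (polar (ln (3 * D)) th + t0 - t1).
    have := cmod_leD (polar (ln (3 * D)) th) (- (t0 - t1)).
    rewrite opprK cmodN cmod_polar lnK ?posrE ?mulr_gt0// addrA -/D.
    lra.
  rewrite lef_pV2 ?posrE ?exprn_gt0 ?mulr_gt0//.
    by rewrite lerXn2r ?nnegrE ?cmod_ge0// mulr_ge0 ?(ltW D0).
  by rewrite (lt_le_trans _ D2)// mulr_gt0.
have f0 : 0 < cmod (f t0) by rewrite cmod_gt0.
pose n := Num.bound (M / cmod (f t0)).
have nP := archi_boundP (divr_ge0 (ltW M0) (ltW f0)); rewrite -/n in nP.
have := GM n; rewrite exprMn invfM mulrA ler_pM2r ?invr_gt0 ?exprn_gt0//.
apply/negP; rewrite -ltNge ltr_pdivrMr ?exprn_gt0// mulrC -ltr_pdivrMr//.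
by rewrite (lt_le_trans nP)// -natrX ler_nat ltnW// ltn_expl.
Qed.

(** [mplus z] is the exponential of [log^+ |z|]. *)
Definition mplus (z : C) : R := Num.max 1 (cmod z).
Definition logp (z : C) : R := ln (mplus z).

Lemma mplus_ge1 z : 1 <= mplus z.
Proof. by rewrite le_max lexx. Qed.

Lemma mplus_gt0 z : 0 < mplus z.
Proof. exact: lt_le_trans (mplus_ge1 z). Qed.

Lemma mplus_ge_cmod z : cmod z <= mplus z.
Proof. by rewrite le_max lexx orbT. Qed.

Lemma logpM z w : logp (z * w) <= logp z + logp w.
Proof.
rewrite /logp -lnM ?posrE ?mplus_gt0// ler_ln ?posrE ?mulr_gt0 ?mplus_gt0//.
rewrite {1}/mplus ge_max cmodM ler_pM ?cmod_ge0 ?mplus_ge_cmod// andbT.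
by rewrite mulr_ege1 ?mplus_ge1.
Qed.

Lemma mplus_horner (p : {poly C}) : p != 0 ->
  exists2 K : R, 0 < K & forall z, mplus z ^+ (size p).-1 <= K * mplus p.[z].
Proof.
move=> p0; have [r pr] := closed_field_poly_normal p.
have c0 : 0 < cmod (lead_coef p) by rewrite cmod_gt0 lead_coef_eq0.
have sp : (size p).-1 = size r.
  by rewrite {1}pr size_scale ?lead_coef_eq0// size_prod_XsubC.
(* Beyond [B] each factor [z - a] of [p] satisfies [|z - a| >= |z| / 2]. *)
pose B : R := 1 + \sum_(a <- r) cmod a *+ 2.
have B1 : 1 <= B by rewrite lerDl sumr_ge0// => a _; rewrite mulrn_wge0 ?cmod_ge0.
have Ba a : a \in r -> cmod a * 2 <= B.
  move=> ar; rewrite /B (big_rem a)//= addrCA mulr_natr lerDl addr_ge0// sumr_ge0//.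
  by move=> b _; rewrite mulrn_wge0 ?cmod_ge0.
set n := (size p).-1.
exists (B ^+ n + 2 ^+ n / cmod (lead_coef p)).
  by rewrite ltr_pwDl ?divr_ge0 ?exprn_gt0 ?exprn_ge0 ?(ltW c0)// (lt_le_trans _ B1).
move=> z; have [zB|Bz] := leP (cmod z) B.
  rewrite (@le_trans _ _ (B ^+ n))//.
    by rewrite lerXn2r ?nnegrE ?(ltW (mplus_gt0 _)) ?(le_trans ler01)// ge_max B1.
  rewrite (@le_trans _ _ (B ^+ n * mplus p.[z]))//.
    by rewrite ler_peMr ?mplus_ge1// exprn_ge0// (le_trans ler01).
  rewrite ler_wpM2r ?(ltW (mplus_gt0 _))// lerDl divr_ge0 ?exprn_ge0 ?(ltW c0)//.
have mz : mplus z = cmod z by apply/max_idPr; rewrite (le_trans B1)// ltW.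
have pz : cmod z ^+ n <= 2 ^+ n / cmod (lead_coef p) * cmod p.[z].
  rewrite [in cmod p.[z]]pr hornerZ horner_prod cmodM mulrA divfK ?gt_eqF//.
  rewrite /n sp; clear -Ba Bz; clearbody B; elim: r Ba => [|a r IH] Ba.
    by rewrite big_nil cmod1 mulr1.
  rewrite big_cons cmodM !exprS mulrACA ler_pM ?cmod_ge0 ?exprn_ge0 ?cmod_ge0//.
    rewrite hornerXsubC; have := cmod_leD z a; have := Ba a (mem_head _ _).
    lra.
  by apply: IH => b br; apply: Ba; rewrite in_cons br orbT.
rewrite mz (le_trans pz)// ler_pM ?cmod_ge0 ?mplus_ge_cmod//.
  by rewrite divr_ge0 ?exprn_ge0 ?(ltW c0).
by rewrite lerDr exprn_ge0// (le_trans ler01).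
Qed.

End Bounds.

(** * The proximity function *)

Section Proximity.
Variable R : realType.
Local Notation C := (CC R).
Implicit Types (u z w q : C -> C) (rho : R).

(** The proximity function of Nevanlinna theory, discretized. *)
Definition prox rho N u : R := cmean rho N (fun t => logp (u t)).

Lemma prox_cst rho N c : (0 < N)%N -> prox rho N (fun=> c) = logp c.
Proof. exact: cmean_cst. Qed.

(** Where [|u| >= 1] the modulus of [q = (w - z) / u] is at most
    [(|w| + |z|) / |u|], and elsewhere it is controlled by [z] alone; Jensen's
    inequality for [q] then bounds the growth of [u] by that of [w] and [z]. *)
Lemma prox_le u z w q (K : R) : entire u -> entire q -> 1 <= K ->
  (forall t, w t = z t + u t * q t) -> q 0 != 0 ->
  (forall t, cmod (u t) <= 1 -> cmod (q t) <= K * (1 + cmod (z t))) ->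
  exists c : R, forall rho, \forall N \near \oo,
    prox rho N u <= prox rho N w + prox rho N z + c.
Proof.
move=> eu eq K1 wE q0 qK.
have K0 : 0 < K by exact: lt_le_trans K1.
exists (ln (2 * K) + 1 - ln (cmod (q 0))) => rho.
have [B B0 HB] := bounded_on_circle rho eu.
(* With [eps <= 1 / max 1 |u|] on the circle, the bound on [|q|] used below also
   holds for its truncation [max |q| eps]. *)
pose eps := (B + 1)^-1; have eps0 : 0 < eps by rewrite invr_gt0 addr_gt0.
have J := @jensen R q rho eps 1 eq q0 eps0 ltr01.
near=> N.
have N0 : (0 < N)%N by near: N; exists 1%N.
have H : ln (cmod (q 0)) <= cmean rho N (fun t => ln (Num.max (cmod (q t)) eps)) + 1.
  by near: N.
have Hle : cmean rho N (fun t => ln (Num.max (cmod (q t)) eps)) <=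
    cmean rho N (fun t => (ln (2 * K) + logp (w t) + logp (z t)) - logp (u t)).
  apply: le_cmean => th th2; set t := polar rho th.
  have K20 : 0 < 2 * K by rewrite mulr_gt0.
  rewrite lerBrDr /logp -!lnM ?posrE ?mulr_gt0 ?mplus_gt0 ?lt_max ?eps0 ?orbT//.
  rewrite ler_ln ?posrE ?mulr_gt0 ?mplus_gt0 ?lt_max ?eps0 ?orbT//.
  have Mw := mplus_ge1 (w t); have Mz := mplus_ge1 (z t).
  have w' := mplus_ge_cmod (w t); have z' := mplus_ge_cmod (z t).
  have Mwz : 1 <= mplus (w t) * mplus (z t) by rewrite mulr_ege1.
  rewrite maxr_pMl ?(ltW (mplus_gt0 _))// ge_max; apply/andP; split; last first.
    rewrite (@le_trans _ _ 1)//.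
      rewrite mulrC ler_pdivrMr ?addr_gt0// mul1r ge_max lerDr (ltW B0)/=.
      by rewrite (le_trans (HB _ th2))// lerDl.
    by rewrite -mulrA mulr_ege1// mulr_ege1// ler1n.
  have [u1|u1] := leP (cmod (u t)) 1.
    have -> : mplus (u t) = 1 by apply/max_idPl.
    rewrite mulr1 (le_trans (qK _ u1))// -mulrA -[leRHS]mulrA mulrCA ler_wpM2l ?(ltW K0)//.
    have : mplus (z t) <= mplus (w t) * mplus (z t).
      by rewrite ler_peMl// (le_trans ler01).
    lra.
  have -> : mplus (u t) = cmod (u t) by apply/max_idPr; exact: ltW.
  rewrite -cmodM mulrC.
  have -> : u t * q t = w t - z t by rewrite wE addrAC subrr add0r.
  rewrite (le_trans (cmodB _ _))//.
  have : mplus (z t) <= mplus (w t) * mplus (z t).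
    by rewrite ler_peMl// (le_trans ler01).
  have : mplus (w t) <= mplus (w t) * mplus (z t).
    by rewrite ler_peMr// (le_trans ler01).
  have : mplus (w t) * mplus (z t) <= K * (mplus (w t) * mplus (z t)).
    by rewrite ler_peMl// (le_trans ler01).
  rewrite -!mulrA; lra.
move: Hle; rewrite cmeanB !cmeanD cmean_cst// -/(prox rho N u) -/(prox rho N w) -/(prox rho N z).
move: H; lra.
Unshelve. all: by end_near. Qed.

End Proximity.

(** * Overshears as automorphisms of the affine space *)

Section DividedDifference.
Variable F : fieldType.
Implicit Types (p : {poly F}) (a b : F).

(** The explicit sum is a polynomial in [a] and [b], hence holomorphic also on the
    diagonal. *)
Definition divdiff p a b : F :=
  \sum_(i < size p) p`_i * \sum_(j < i) a ^+ (i.-1 - j) * b ^+ j.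

Lemma divdiffE p a b : p.[a] - p.[b] = (a - b) * divdiff p a b.
Proof.
rewrite !horner_coef -sumrB mulr_sumr; apply: eq_bigr => i _.
by rewrite -mulrBr subrXX mulrCA.
Qed.

Lemma divdiff_diag p a : divdiff p a a = p^`().[a].
Proof.
rewrite -{2}[p]coefK poly_def raddf_sum /= horner_sum; apply: eq_bigr => i _.
rewrite derivZ derivXn hornerZ hornerMn hornerXn; congr (_ * _).
rewrite (eq_bigr (fun=> a ^+ i.-1)); last first.
  move=> j _; rewrite -exprD subnK// -ltnS prednK ?ltn_ord//.
  exact: leq_ltn_trans (ltn_ord j).
by rewrite sumr_const card_ord.
Qed.

Lemma simple_root_deriv p a : p != 0 -> mup a p = 1%N -> p^`().[a] != 0.
Proof.
move=> p0 m1; have : 'X - a%:P %| p by rewrite XsubC_dvd// m1.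
move=> /dvdpP[q pq]; rewrite pq derivM derivXsubC mulr1 hornerD hornerM.
rewrite hornerXsubC subrr mulr0 add0r; apply/negP => q0.
have : (2 <= mup a p)%N; last by rewrite m1.
rewrite mup_geq// pq expr2 dvdp_mul// dvdp_XsubCl; exact: q0.
Qed.

End DividedDifference.

Section Letters.
Variables (R : realType) (p : {poly CC R}).
Local Notation C := (CC R).
Local Notation C3 := (C * C * C)%type.

Lemma hol_divdiff (V : normedModType C) (F G : V -> C) : hol F -> hol G -> hol (fun v => divdiff p (F v) (G v)).
Proof.
move=> hF hG; apply: hol_sum => i; apply: holM; first exact: hol_cst.
by apply: hol_sum => j; apply: holM; exact: holX.
Qed.

Implicit Types (f g : C -> C) (v : C3).

(** [slope f g x z] is the displacement of [z] under [O_{f,g}] divided by [x],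
    and its continuation across [x = 0]. *)
Definition slope_coef f x : C := f x * cexpm1 (x * f x).
Definition slope f g (x z : C) : C := z * slope_coef f x + g x.

(** Written without division, an overshear makes sense on all of [C^3], where it
    preserves the function [x * y - p(z)] and not only its zero fibre. *)
Definition oshear f g v : C3 :=
  let w := v.2 + v.1.1 * slope f g v.1.1 v.2 in
  (v.1.1, v.1.2 + slope f g v.1.1 v.2 * divdiff p w v.2, w).

Lemma entire_slope_coef f : entire f -> entire (slope_coef f).
Proof.
by move=> ef; exact: holM ef (hol_comp (@entire_cexpm1 R) (holM hol_id ef)).
Qed.

Lemma slopeE f g x z : z * cexp (x * f x) + x * g x = z + x * slope f g x z.
Proof. by rewrite cexp_expm1 /slope /slope_coef; ring. Qed.

Lemma overshear_funE f g v : overshear_fun p f g v = oshear f g v.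
Proof.
case: v => [[x y] z]; rewrite /overshear_fun /oshear /= slopeE.
congr (_, _ + _, _); case: eqP => [->|/eqP x0].
  by rewrite mul0r addr0 divdiff_diag mulrC /slope /slope_coef mul0r cexpm1_0 mulr1.
by rewrite divdiffE [_ + x * _]addrC addrK -mulrA mulKf.
Qed.

Lemma oshear_fibre f g v :
  (oshear f g v).1.1 * (oshear f g v).1.2 - p.[(oshear f g v).2] =
  v.1.1 * v.1.2 - p.[v.2].
Proof.
case: v => [[x y] z] /=; set w := z + _.
have := divdiffE p w z; rewrite {2}/w [_ + x * _]addrC addrK => E.
by rewrite mulrDr mulrA -E; ring.
Qed.

Lemma oshear_comp f g f' g' v :
  oshear f g (oshear f' g' v) =
  oshear (fun x => f' x + f x) (fun x => g' x * cexp (x * f x) + g x) v.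
Proof.
case: v => [[x y] z]; rewrite /oshear /=; set w' := z + _.
set w := w' + _; set s := slope (fun x => f' x + f x) _ x z.
have ww : w = z + x * s.
  rewrite /w /s -!slopeE mulrDr cexpD /w' -slopeE; ring.
have key : slope f' g' x z * divdiff p w' z + slope f g x w' * divdiff p w w' =
    s * divdiff p w z.
  have [x0|x0] := eqVneq x 0.
    have wz : w = z by rewrite ww x0 mul0r addr0.
    have wz' : w' = z by rewrite /w' x0 mul0r addr0.
    rewrite wz wz' -mulrDl /s /slope /slope_coef x0 !mul0r cexpm1_0 cexp0.
    by congr (_ * _); ring.
  have E1 : x * (slope f' g' x z * divdiff p w' z) = p.[w'] - p.[z].
    by rewrite mulrA divdiffE /w' [_ + x * _]addrC addrK.
  have E2 : x * (slope f g x w' * divdiff p w w') = p.[w] - p.[w'].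
    by rewrite mulrA divdiffE /w [_ + x * _]addrC addrK.
  have E3 : x * (s * divdiff p w z) = p.[w] - p.[z].
    by rewrite mulrA divdiffE {2}ww [_ + x * _]addrC addrK.
  by apply: (mulfI x0); rewrite [LHS]mulrDr [RHS]E3 E1 E2 addrC addrA subrK.
by rewrite -ww -addrA key.
Qed.

Lemma oshear_id v : oshear (fun=> 0) (fun=> 0) v = v.
Proof.
case: v => [[x y] z]; rewrite /oshear /slope /slope_coef /=.
by rewrite !(mul0r, mulr0, addr0).
Qed.

Lemma hol_slope f g (V : normedModType C) (F G : V -> C) : entire f -> entire g ->
  hol F -> hol G -> hol (fun u => slope f g (F u) (G u)).
Proof.
move=> ef eg hF hG; apply: holD (hol_comp eg hF).
exact: holM hG (hol_comp (entire_slope_coef ef) hF).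
Qed.

Lemma hol_oshear f g : entire f -> entire g -> hol (oshear f g).
Proof.
move=> ef eg.
have hx : hol (fun v : C3 => v.1.1) by apply: hol_fst; apply: hol_fst.
have hy : hol (fun v : C3 => v.1.2) by apply: hol_snd; apply: hol_fst.
have hz : hol (fun v : C3 => v.2) by apply: hol_snd.
have hs := hol_slope ef eg hx hz.
have hw := holD hz (holM hx hs).
exact: hol_pair (hol_pair hx (holD hy (holM hs (hol_divdiff hw hz)))) hw.
Qed.

Lemma hol_swap : hol (@swap_fun R).
Proof.
have -> : @swap_fun R = fun v => (v.1.2, v.1.1, v.2).
  by apply/funext => -[[x y] z].
apply: hol_pair; last by apply: hol_snd.
by apply: hol_pair; [apply: hol_snd; apply: hol_fst|apply: hol_fst; apply: hol_fst].
Qed.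

End Letters.

(** * Words in overshears *)

Section Words.
Variables (R : realType) (p : {poly CC R}).
Local Notation C := (CC R).
Local Notation C3 := (C * C * C)%type.
Local Notation D := (danielewski p).

(** A letter [(b, f, g)] stands for the overshear [O_{f,g}] when [b] is false,
    and for its conjugate by the swap, which fixes [y] instead of [x], when [b]
    is true. *)
Definition letter := (bool * (C -> C) * (C -> C))%type.
Implicit Types (a : letter) (l : seq letter) (v : C3).

Definition side a : bool := a.1.1.
Definition entire_letter a : Prop := entire a.1.2 /\ entire a.2.

Definition flip (b : bool) v : C3 := if b then swap_fun v else v.

Definition act a v : C3 := flip (side a) (oshear p a.1.2 a.2 (flip (side a) v)).

Definition actD a : D -> D :=
  if side a then @swap R p \o overshear a.1.2 a.2 \o @swap R p
  else overshear a.1.2 a.2.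

Definition word l v : C3 := foldl (fun u a => act a u) v l.
Definition wordD l (v : D) : D := foldl (fun u a => actD a u) v l.

Definition on_D v : Prop := v.1.1 * v.1.2 = p.[v.2].

Lemma on_DP v : reflect (on_D v) (on_danielewski p v).
Proof. by case: v => [[x y] z]; exact: eqP. Qed.

Lemma flipK b : involutive (flip b).
Proof. by case: b => [] [[x y] z]. Qed.

Lemma on_D_flip b v : on_D (flip b v) <-> on_D v.
Proof. by case: b v => [] [[x y] z]; rewrite /on_D /= // mulrC. Qed.

Lemma on_D_act a v : on_D (act a v) <-> on_D v.
Proof.
rewrite /act on_D_flip -[X in _ <-> X](on_D_flip (side a)); move: (flip _ v) => {}v.
have := oshear_fibre p a.1.2 a.2 v; rewrite /on_D => E.
by split=> H; apply/eqP; rewrite -subr_eq0; [rewrite -E|rewrite E]; rewrite H subrr.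
Qed.

Lemma val_actD a (v : D) : val (actD a v) = act a (val v).
Proof.
rewrite /actD /act /flip; case: (side a); last by rewrite -overshear_funE.
by rewrite -overshear_funE.
Qed.

Lemma val_wordD l (v : D) : val (wordD l v) = word l (val v).
Proof. by elim: l v => [//|a l IH] v /=; rewrite IH val_actD. Qed.

Lemma hol_flip b : hol (flip b).
Proof. by case: b => v; [exact: hol_swap|exact: ex_diff]. Qed.

Lemma hol_act a : entire_letter a -> hol (act a).
Proof.
move=> [ef eg] v; apply: (@differentiable_comp _ _ _ _ _ (flip (side a))).
  apply: differentiable_comp; first exact: hol_flip.
  exact: hol_oshear.
exact: hol_flip.
Qed.

Definition comp_letter a a' : letter :=
  (side a, fun x => a.1.2 x + a'.1.2 x,
   fun x => a.2 x * cexp (x * a'.1.2 x) + a'.2 x).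

Lemma act_comp a a' v : side a = side a' ->
  act a' (act a v) = act (comp_letter a a') v.
Proof. by move=> e; rewrite /act /= -e flipK oshear_comp. Qed.

Lemma entire_comp_letter a a' : entire_letter a -> entire_letter a' ->
  entire_letter (comp_letter a a').
Proof.
move=> [ef eg] [ef' eg']; split => /=; first exact: holD.
exact: holD (holM eg (hol_comp (@entire_cexp R) (holM hol_id ef'))) eg'.
Qed.

Definition inv_letter a : letter :=
  (side a, fun x => - a.1.2 x, fun x => - (a.2 x * cexp (x * - a.1.2 x))).

Lemma entire_inv_letter a : entire_letter a -> entire_letter (inv_letter a).
Proof.
move=> [ef eg]; split => /=; first exact: holN.
exact: holN (holM eg (hol_comp (@entire_cexp R) (holM hol_id (holN ef)))).
Qed.

Lemma act_id b v : act (b, fun=> 0, fun=> 0) v = v.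
Proof. by rewrite /act /= oshear_id flipK. Qed.

Lemma comp_letterV a : comp_letter a (inv_letter a) = (side a, fun=> 0, fun=> 0).
Proof.
rewrite /comp_letter; congr (_, _, _); apply/funext => x /=.
  exact: subrr.
exact: subrr.
Qed.

Lemma comp_Vletter a : comp_letter (inv_letter a) a = (side a, fun=> 0, fun=> 0).
Proof.
rewrite /comp_letter; congr (_, _, _); apply/funext => x /=.
  exact: addNr.
by rewrite mulNr -mulrA -cexpD mulrN addNr cexp0 mulr1 addNr.
Qed.

Lemma inv_letterK a v : act (inv_letter a) (act a v) = v.
Proof. by rewrite act_comp// comp_letterV act_id. Qed.

Lemma inv_letterVK a v : act a (act (inv_letter a) v) = v.
Proof. by rewrite (@act_comp (inv_letter a) a)// comp_Vletter act_id. Qed.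

Fixpoint entire_word l : Prop :=
  if l is a :: l' then entire_letter a /\ entire_word l' else True.

Lemma entire_word_cat l l' : entire_word l -> entire_word l' -> entire_word (l ++ l').
Proof.
move=> hl hl'; elim: l hl => [_|a l IH [ha hl]]; first exact: hl'.
by split; [exact: ha|exact: IH].
Qed.

Lemma word_inverse l : entire_word l -> exists2 l', entire_word l' &
  (forall v, word l' (word l v) = v) /\ (forall v, word l (word l' v) = v).
Proof.
elim: l => [|a l IH]; first by exists [::].
move=> [ha /IH[l' hl' [c1 c2]]]; exists (l' ++ [:: inv_letter a]).
  apply: (entire_word_cat hl').
  by split; [exact: entire_inv_letter|].
split=> v; rewrite /word foldl_cat -/(word _ _) /=.
  by rewrite -/(word l _) -/(word l' _) c1 inv_letterK.
by rewrite inv_letterVK -/(word l _) -/(word l' _) c2.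
Qed.

Lemma wordD_cat l l' : wordD (l ++ l') = wordD l' \o wordD l.
Proof. by apply/funext => v; rewrite /wordD foldl_cat. Qed.

Lemma holomorphic_of_hol (phi : D -> D) (F : C3 -> C3) : hol F ->
  (forall w, val (phi w) = F (val w)) -> holomorphic phi.
Proof.
move=> hF E v; exists F; near=> u; split; first exact: hF.
by move=> w <-.
Unshelve. all: by end_near. Qed.

Lemma hol_word l : entire_word l -> hol (word l).
Proof.
elim: l => [|a l IH] => [_ v|[ha /IH hl] v]; first exact: ex_diff.
by apply: (@differentiable_comp _ _ _ _ (act a) (word l)); [exact: hol_act|exact: hl].
Qed.

Lemma hol_aut_word l : entire_word l -> hol_aut p (wordD l).
Proof.
move=> hl; have [l' hl' [c1 c2]] := word_inverse hl.
split; first exact: (holomorphic_of_hol (hol_word hl) (val_wordD l)).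
exists (wordD l'); split.
- exact: (holomorphic_of_hol (hol_word hl') (val_wordD l')).
- by move=> v; apply: val_inj; rewrite !val_wordD c1.
- by move=> v; apply: val_inj; rewrite !val_wordD c2.
Qed.

Definition word_group : set (D -> D) :=
  [set phi | exists2 l, entire_word l & phi = wordD l].

Lemma word_group_subgroup : is_subgroup (hol_aut p) word_group.
Proof.
split.
- by move=> phi [l hl ->]; exact: hol_aut_word.
- by exists [::].
- move=> phi psi [l hl ->] [l' hl' ->]; exists (l' ++ l).
    exact: entire_word_cat.
  by rewrite wordD_cat.
- move=> phi psi [l hl ->] c1 c2; have [l' hl' [_ c]] := word_inverse hl.
  exists l' => //; apply/funext => v.
  have -> : v = wordD l (wordD l' v) by apply: val_inj; rewrite !val_wordD c.
  rewrite c1; congr wordD; apply: val_inj.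
  by rewrite !val_wordD c.
Qed.

Lemma overshears_sub_word_group : @overshears R p `<=` word_group.
Proof.
move=> phi [f [g [ef eg [->|->]]]].
  by exists [:: (false, f, g)].
by exists [:: (true, f, g)].
Qed.

Lemma overshear_group_word phi : overshear_group p phi ->
  exists2 l, entire_word l & phi = wordD l.
Proof.
exact: (smallest_sub word_group_subgroup overshears_sub_word_group).
Qed.

(** The ambient set contains a subgroup containing the overshears, so their
    smallest one exists and inherits the closure properties. *)
Lemma overshear_group_subgroup : is_subgroup (hol_aut p) (overshear_group p).
Proof.
split.
- by move=> phi /overshear_group_word[l hl ->]; exact: hol_aut_word.
- by move=> S [[]].
- move=> phi psi hphi hpsi S HS; case: (HS) => -[_ _ h _] _.
  by apply: h; [exact: hphi|exact: hpsi].
- move=> phi psi hphi c1 c2 S HS; case: (HS) => -[_ _ _ h] _.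
  by apply: (h phi) => //; exact: hphi.
Qed.

(** * Reduced words *)

Definition nontrivial a : Prop := exists x, slope_coef a.1.2 x != 0 \/ a.2 x != 0.

Fixpoint reduced l : Prop :=
  if l is a :: l' then
    [/\ nontrivial a, (if l' is a' :: _ then side a' = ~~ side a else True) &
      reduced l']
  else True.

Lemma act_trivial a v : ~ nontrivial a -> act a v = v.
Proof.
move=> na; have a0 x : slope_coef a.1.2 x = 0 /\ a.2 x = 0.
  by split; apply/eqP; apply/negP => /negP H; apply: na; exists x; [left|right].
rewrite /act; move: (flip (side a) v) (flipK (side a) v) => u.
have -> : oshear p a.1.2 a.2 u = u; last by [].
case: u => [[x y] z]; rewrite /oshear /slope /=.
by have [-> ->] := a0 x; rewrite mulr0 addr0 mul0r mulr0 !addr0.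
Qed.

(** Letters of the same side merge, and trivial letters are dropped. *)
Lemma reduce_word l : entire_word l -> exists l', [/\ entire_word l', reduced l' &
  forall v, word l' v = word l v].
Proof.
elim: l => [_|a l IH]; first by exists [::].
move=> [ha /IH[l' [hl' rl' E]]].
have [na|na] := pselect (nontrivial a); last first.
  by exists l'; split => // v; rewrite E /= act_trivial.
case: l' hl' rl' E => [|a' l'] hl' rl' E.
  by exists [:: a]; split => //; move=> v; rewrite /= -E.
have [sa|sa] := eqVneq (side a') (side a); last first.
  exists (a :: a' :: l'); split; first by split.
    by split => //; move: sa; case: (side a') (side a) => [] [].
  by move=> v; rewrite [LHS]/= -[RHS]E.
move: hl' => [ha' hl'].
case: rl' => na' sl' rl'; pose m := comp_letter a a'.
have Em v : word l' (act m v) = word (a :: l) v.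
  by rewrite -act_comp// -[RHS]E.
have [nm|nm] := pselect (nontrivial m); last first.
  by exists l'; split => // v; rewrite -Em act_trivial.
exists (m :: l'); split; last exact: Em.
  by split; [exact: entire_comp_letter|exact: hl'].
by split => //; case: l' {hl' rl' Em E} sl' => // a'' l' ->; rewrite sa.
Qed.

End Words.

(** * Generic points *)

Section Generic.
Variables (R : realType) (p : {poly CC R}).
Local Notation C := (CC R).
Local Notation C3 := (C * C * C)%type.
Local Notation letter := (letter R).
Implicit Types (a : letter) (l : seq letter) (v : C3) (U : set C3).

(** The coordinate fixed by the letters of side [b], and the other one. *)
Definition fixed b v : C := (flip b v).1.1.
Definition moved b v : C := (flip b v).1.2.

Definition displacement a v : C :=
  slope a.1.2 a.2 (fixed (side a) v) v.2.

Lemma flip2 b v : (flip b v).2 = v.2.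
Proof. by case: b v => [] [[]]. Qed.

Lemma fixedN b v : fixed (~~ b) v = moved b v.
Proof. by case: b v => [] [[]]. Qed.

Lemma movedN b v : moved (~~ b) v = fixed b v.
Proof. by case: b v => [] [[]]. Qed.

Lemma on_D_fixed b v : on_D p v <-> fixed b v * moved b v = p.[v.2].
Proof. by rewrite -(on_D_flip p b) /on_D flip2. Qed.

Lemma act_fixed a v : fixed (side a) (act p a v) = fixed (side a) v.
Proof. by rewrite /fixed /act flipK. Qed.

Lemma act_z a v : (act p a v).2 = v.2 + fixed (side a) v * displacement a v.
Proof. by rewrite /act flip2 /oshear /= flip2. Qed.

Lemma hol_fixed b : hol (fixed b).
Proof. by apply: hol_fst; apply: hol_fst; exact: hol_flip. Qed.

Lemma hol_displacement a : entire_letter a -> hol (displacement a).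
Proof.
move=> [ef eg]; apply: hol_slope => //; first exact: hol_fixed.
by apply: hol_snd.
Qed.

Lemma open_neq0 (V : normedModType C) (F : V -> C) : hol F -> open [set u | F u != 0].
Proof.
move=> hF; have -> : [set u | F u != 0] = F @^-1` (~` [set 0]).
  by apply/seteqP; split=> u /=; [move/eqP|move/eqP].
apply: (continuousP _).1; first exact: hol_continuous hF.
rewrite openE => s /= s0; apply/nbhs_cmodP.
exists (cmod s); first by rewrite cmod_gt0; apply/eqP.
by move=> t ts t0; move: ts; rewrite t0 sub0r cmodN ltxx.
Qed.

(** The condition [q(0) != 0] under which Jensen's inequality is applied, for all
    letters of a word in turn. *)
Fixpoint generic l v : Prop :=
  if l is a :: l' then displacement a v != 0 /\ generic l' (act p a v) else True.

Lemma perturb U (k : C -> C3) : open U -> U (k 0) -> {for 0, continuous k} ->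
  exists2 d : R, 0 < d & forall s, cmod s < d -> U (k s).
Proof.
move=> oU Uk ck; have /ck : nbhs (k 0) U by apply: open_nbhs_nbhs.
move=> /nbhs_cmodP[d d0 Hd]; exists d => // s sd; apply: Hd; by rewrite subr0.
Qed.

Lemma small_complex (d : R) : 0 < d -> exists2 s : C, s != 0 & cmod s < d.
Proof.
move=> d0; exists (real_complex R (d / 2)).
  by rewrite eq_complex /= eqxx andbT gt_eqF// divr_gt0.
rewrite cmodE expr0n addr0 sqrtr_sqr gtr0_norm ?divr_gt0//.
by rewrite ltr_pdivrMr// ltr_pMr// ltr1n.
Qed.

Hypothesis simple_zeros : forall a : C, root p a -> mup a p = 1%N.
Hypothesis p0 : p != 0.

(** On the line [x = 0] the polynomial vanishes, and an overshear fixing [y]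
    moves [x] at first order at speed [p'(z) != 0]. *)
Lemma leave_axis U v : open U -> U v -> on_D p v ->
  exists v', [/\ U v', on_D p v' & v'.1.1 != 0].
Proof.
case: v => [[x y] z] oU Uv Dv; have [x0|x0] := eqVneq x 0; last by exists (x, y, z).
have rz : p.[z] = 0 by move: Dv; rewrite /on_D /= x0 mul0r.
have dz : p^`().[z] != 0.
  by apply: simple_root_deriv => //; apply: simple_zeros; apply/eqP.
pose D s := divdiff p (z + y * s) z.
have eD : hol D.
  apply: hol_divdiff; last exact: hol_cst.
  by apply: holD; [exact: hol_cst|apply: holM; [exact: hol_cst|]].
pose k (s : C) : C3 := (s * D s, y, z + y * s).
have hk : hol k.
  apply: hol_pair; last by apply: holD; [exact: hol_cst|apply: holM; [exact: hol_cst|]].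
  by apply: hol_pair; [exact: holM|exact: hol_cst].
have k0 : k 0 = (x, y, z) by rewrite /k mul0r mulr0 addr0 x0.
have [d d0 Hd] : exists2 d : R, 0 < d & forall s, cmod s < d -> U (k s).
  by apply: (perturb oU); [rewrite k0|exact: hol_continuous].
have D0 : D 0 != 0 by rewrite /D mulr0 addr0 divdiff_diag.
have [e e0 He] : exists2 e : R, 0 < e & forall s, cmod s < e -> D s != 0.
  have /continuous_cmodP cD := hol_continuous eD (x := 0).
  have D0' : 0 < cmod (D 0) by rewrite cmod_gt0.
  have [e e0 He] := cD _ D0'; exists e; first exact: e0.
  move=> s se.
  have := He s; rewrite subr0 => /(_ se) H.
  by apply/negP => /eqP Ds; move: H; rewrite Ds sub0r cmodN ltxx.
have de : 0 < Num.min d e by rewrite lt_min d0.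
have [s s0] := small_complex de; rewrite lt_min => /andP[sd se].
exists (k s); split; first exact: Hd.
  rewrite /on_D /k /=; have := divdiffE p (z + y * s) z.
  by rewrite rz subr0 => ->; rewrite addrAC subrr add0r -/(D s); ring.
exact: mulf_neq0 s0 (He _ se).
Qed.

(** A non-trivial letter has zero displacement only along an analytic subset: once
    [x != 0], the coordinates [x] and [z] move freely, first [z] so that the slope
    is not identically zero in [x], then [x] by the identity theorem. *)
Lemma perturb_displacement a U v : entire_letter a -> nontrivial a ->
  open U -> U v -> on_D p v -> exists v', [/\ U v', on_D p v' & displacement a v' != 0].
Proof.
move=> ea na oU Uv Dv; wlog sa : a U v ea na oU Uv Dv / side a = false.
  move=> H; case sa : (side a); last exact: (H a U v).
  have oU' : open (flip true @^-1` U).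
    by apply: (continuousP _).1 => //; exact: hol_continuous (@hol_flip R true).
  have Uv' : (flip true @^-1` U) (flip true v) by move: Uv; rewrite -{1}[v](flipK true).
  have Dv' : on_D p (flip true v) by apply/on_D_flip.
  have [v' [Uw Dw dw]] := H (false, a.1.2, a.2) _ _ ea na oU' Uv' Dv' erefl.
  exists (flip true v'); split; [exact: Uw|exact/on_D_flip|].
  by move: dw; rewrite /displacement sa /fixed flipK [(flip true v').2]flip2.
have [v1 [U1 D1 x10]] := leave_axis oU Uv Dv.
case: v1 U1 D1 x10 => [[x1 y1] z1] /= U1 D1 x10.
case: ea => ef eg; set f := a.1.2 in ef *; set g := a.2 in eg *.
have eA := entire_slope_coef ef.
have y1E : y1 = p.[z1] / x1 by rewrite -D1 /= mulrAC divff ?mul1r.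
have [z' [Uz' [x' nx']]] : exists z', U (x1, p.[z'] / x1, z') /\ exists x', slope f g x' z' != 0.
  have [[x' nx']|nz1] := pselect (exists x', slope f g x' z1 != 0).
    by exists z1; rewrite -y1E; split => //; exists x'.
  have z1s x : slope f g x z1 = 0.
    by apply/eqP; apply/negP => /negP H; apply: nz1; exists x.
  pose k (s : C) : C3 := (x1, p.[z1 + s] / x1, z1 + s).
  have hz : hol (fun s : C => z1 + s) by apply: holD; [exact: hol_cst|].
  have hk : hol k.
    apply: hol_pair => //; apply: hol_pair; first exact: hol_cst.
    apply: holM; last exact: hol_cst.
    under eq_fun do rewrite horner_coef.
    by apply: hol_sum => i; apply: holM; [exact: hol_cst|exact: holX].
  have [d d0 Hd] : exists2 d : R, 0 < d & forall s, cmod s < d -> U (k s).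
    apply: (perturb oU); last exact: hol_continuous.
    by rewrite /k !addr0 -y1E.
  have [s s0 sd] := small_complex d0; exists (z1 + s); split; first exact: Hd.
  case: na => x' nx'; exists x'; rewrite -/f -/g in nx'.
  have -> : slope f g x' (z1 + s) = s * slope_coef f x'.
    by rewrite /slope mulrDl addrAC -/(slope f g x' z1) z1s add0r.
  rewrite mulf_neq0//; apply/negP => /eqP A0; case: nx'; first by rewrite A0 eqxx.
  by have := z1s x'; rewrite /slope A0 mulr0 add0r => ->; rewrite eqxx.
pose k (s : C) : C3 := (x1 + s, p.[z'] / (x1 + s), z').
have ck : {for 0, continuous k}.
  apply: differentiable_continuous.
  have dx : differentiable (fun s : C => x1 + s) (0 : C).
    by apply: (@holD _ _ (fun=> x1) id); [exact: hol_cst|].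
  apply: differentiable_pair; last exact: differentiable_cst.
  apply: (differentiable_pair dx); apply: (differentiableM (differentiable_cst _ _)).
  by apply: (differentiableV dx); rewrite addr0.
have [d d0 Hd] : exists2 d : R, 0 < d & forall s, cmod s < d -> U (k s).
  by apply: (perturb oU) => //; rewrite /k addr0.
have es : entire (fun x => slope f g x z').
  exact: holD (holM (hol_cst z') eA) eg.
have dx : 0 < Num.min d (cmod x1) by rewrite lt_min d0 cmod_gt0.
have [x2] := identity_theorem x1 es nx' dx.
rewrite lt_min => /andP[x2d x2x] nx2.
have x20 : x2 != 0.
  by apply/negP => /eqP x2e; move: x2x; rewrite x2e sub0r cmodN ltxx.
have k2 : k (x2 - x1) = (x2, p.[z'] / x2, z') by rewrite /k addrC subrK.
exists (k (x2 - x1)); split; first exact: Hd.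
  by rewrite k2 /on_D /= mulrC divfK.
by rewrite k2 /displacement sa.
Qed.

(** Generic points are dense: the letters act by homeomorphisms, so each
    condition can be pulled back and imposed by an arbitrarily small move. *)
Lemma generic_dense l U v : entire_word l -> reduced l -> open U -> U v -> on_D p v ->
  exists v', [/\ U v', on_D p v' & generic l v'].
Proof.
elim: l U v => [|a l IH] U v; first by exists v.
move=> [ha hl] [na _ rl] oU Uv Dv.
have [v1 [U1 D1 d1]] := perturb_displacement ha na oU Uv Dv.
pose ai := inv_letter a.
have hai : entire_letter ai by exact: entire_inv_letter.
pose U' := U `&` [set u | displacement a u != 0].
have oU' : open U'.
  by apply: openI; [exact: oU|exact: open_neq0 (hol_displacement ha)].
have oV : open (act p ai @^-1` U').
  by apply: (continuousP _).1 => //; exact: hol_continuous (hol_act p hai).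
have V1 : (act p ai @^-1` U') (act p a v1) by rewrite /preimage /= inv_letterK.
have [v2 [U2 D2 g2]] := IH _ _ hl rl oV V1 ((on_D_act p a v1).2 D1).
exists (act p ai v2); case: U2 => U2 d2; split => //; first exact/on_D_act.
by rewrite /= inv_letterVK.
Qed.

End Generic.

(** * Growth along a word *)

Section Growth.
Variables (R : realType) (p : {poly CC R}).
Local Notation C := (CC R).
Local Notation C3 := (C * C * C)%type.
Local Notation letter := (letter R).
Implicit Types (a : letter) (l : seq letter) (v : C3) (gamma : C -> C3).
Hypothesis deg_p : (4 <= (size p).-1)%N.

Lemma p_neq0 : p != 0.
Proof. by apply: contraTneq deg_p => ->; rewrite size_poly0. Qed.

Lemma logp_horner : exists c : R, forall u v z : C, u * v = p.[z] ->
  4 * logp z <= logp u + logp v + c.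
Proof.
have [K K0 HK] := mplus_horner p_neq0; exists (ln K) => u v z e.
rewrite (@le_trans _ _ (ln K + logp p.[z]))//; last first.
  by rewrite addrC lerD2r -e logpM.
rewrite /logp -lnM ?posrE ?mplus_gt0// -[4 * _]/(4%:R * _) mulr_natl.
rewrite -lnXn ?mplus_gt0// ler_ln ?posrE ?exprn_gt0 ?mulr_gt0 ?mplus_gt0//.
by rewrite (le_trans _ (HK z))// ler_weXn2l// mplus_ge1.
Qed.

Lemma prox_horner (u v z : C -> C) : (forall t, u t * v t = p.[z t]) ->
  exists c : R, forall rho N, (0 < N)%N ->
    4 * prox rho N z <= prox rho N u + prox rho N v + c.
Proof.
move=> e; have [c Hc] := logp_horner; exists c => rho N N0.
rewrite /prox -cmeanZ -[c](cmean_cst rho c N0) -!cmeanD.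
by apply: le_cmean => th _; exact: Hc.
Qed.

Lemma bounded_slope (f g : C -> C) : entire f -> entire g ->
  exists2 K : R, 1 <= K & forall x z, cmod x <= 1 -> cmod (slope f g x z) <= K * (1 + cmod z).
Proof.
move=> ef eg; have [K1 K11 H1] := bounded_on_disc (entire_slope_coef ef).
have [K2 K21 H2] := bounded_on_disc eg; exists (K1 + K2); first by rewrite ler_wpDl// (le_trans ler01).
move=> x z x1; rewrite (le_trans (cmodD _ _))// cmodM.
have z0 := cmod_ge0 z.
have h1 : cmod z * cmod (slope_coef f x) <= cmod z * K1 by rewrite ler_wpM2l// H1.
have h2 : 0 <= cmod z * K2 by rewrite mulr_ge0// (le_trans ler01).
have h3 := H2 _ x1; nra.
Qed.

(** Along an entire curve in the surface let [A0, A1, A2, ...] be the proximity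
    functions of the successive moved and fixed coordinates.  Since the product
    of two consecutive ones is [p(z)] with [deg p >= 4], the proximity function
    of [z] is at most a quarter of their sum, and [prox_le] then yields
    [A(i+1) >= 2 A(i) - A(i-1)] up to bounded terms: the growth never drops, and
    [z] keeps at least half of it. *)
Lemma growth l gamma b (c0 : R) : entire_word l -> reduced l ->
  (if l is a :: _ then side a = b else False) ->
  hol gamma -> (forall t, on_D p (gamma t)) -> generic p l (gamma 0) ->
  exists c : R, forall rho, \forall N \near \oo,
    prox rho N (fun t => moved b (gamma t)) <= prox rho N (fun t => fixed b (gamma t)) + c0 ->
    prox rho N (fun t => fixed b (gamma t)) <= 2 * prox rho N (fun t => (word p l (gamma t)).2) + c.
Proof.
elim: l gamma b c0 => [|a l IH] gamma b c0 //.
move=> [ha hl] [na sl rl] sa hg Dg [d0 gl].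
pose gamma' t := act p a (gamma t).
have hg' : hol gamma'.
  by move=> t; apply: (@differentiable_comp _ _ _ _ gamma (act p a)); [exact: hg|exact: hol_act].
have Dg' t : on_D p (gamma' t) by apply/on_D_act.
have hfix (k : C -> C3) : hol k -> entire (fun t => fixed b (k t)).
  by move=> hk t; apply: (@differentiable_comp _ _ _ _ k (fixed b)); [exact: hk|exact: hol_fixed].
have eq : entire (fun t => displacement a (gamma t)).
  move=> t; apply: (@differentiable_comp _ _ _ _ gamma (displacement a)).
    exact: hg.
  exact: hol_displacement.
have fixE t : fixed b (gamma' t) = fixed b (gamma t) by rewrite -sa act_fixed.
have [K K1 HK] := bounded_slope ha.1 ha.2.
have [c1 Hc1] := @prox_le R (fun t => fixed b (gamma t)) (fun t => (gamma t).2)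
  (fun t => (gamma' t).2) (fun t => displacement a (gamma t)) K (hfix _ hg) eq K1
  (fun t => ltac:(by rewrite /gamma' act_z sa)) d0
  (fun t => ltac:(by rewrite /displacement sa; exact: HK)).
have [c2 Hc2] := @prox_horner (fun t => fixed b (gamma t)) (fun t => moved b (gamma t))
  (fun t => (gamma t).2) (fun t => (on_D_fixed p b _).1 (Dg t)).
have prodE t : fixed b (gamma t) * moved b (gamma' t) = p.[(gamma' t).2].
  by rewrite -fixE; exact: (on_D_fixed p b _).1 (Dg' t).
have [c3 Hc3] := @prox_horner (fun t => fixed b (gamma t)) (fun t => moved b (gamma' t))
  (fun t => (gamma' t).2) prodE.
case: l IH hl sl rl gl => [|a' l] IH hl sl rl gl.
  exists ((c0 + c2) / 2 + 2 * c1) => rho; near=> N => le01.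
  have N0 : (0 < N)%N by near: N; exists 1%N.
  have h1 : prox rho N (fun t => fixed b (gamma t)) <=
    prox rho N (fun t => (gamma' t).2) + prox rho N (fun t => (gamma t).2) + c1.
    by near: N; exact: Hc1.
  have h2 := Hc2 rho N N0; rewrite [word _ _]/=.
  move: h1 h2 le01; rewrite -/(gamma' _) /=; lra.
pose c0' := c0 + c2 + 4 * c1 + c3.
have [c4 Hc4] := IH gamma' (~~ b) c0' hl rl ltac:(by rewrite sl sa) hg' Dg' gl.
exists (c4 + c0') => rho; near=> N => le01.
have N0 : (0 < N)%N by near: N; exists 1%N.
have h1 : prox rho N (fun t => fixed b (gamma t)) <=
  prox rho N (fun t => (gamma' t).2) + prox rho N (fun t => (gamma t).2) + c1.
  by near: N; exact: Hc1.
have h2 := Hc2 rho N N0; have h3 := Hc3 rho N N0.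
have h4 : prox rho N (fun t => moved (~~ b) (gamma' t)) <= prox rho N (fun t => fixed (~~ b) (gamma' t)) + c0' ->
    prox rho N (fun t => fixed (~~ b) (gamma' t)) <= 2 * prox rho N (fun t => (word p (a' :: l) (gamma' t)).2) + c4.
  by near: N; exact: Hc4.
have e1 : prox rho N (fun t => moved (~~ b) (gamma' t)) = prox rho N (fun t => fixed b (gamma t)).
  by congr prox; apply/funext => t; rewrite movedN fixE.
have e2 : prox rho N (fun t => fixed (~~ b) (gamma' t)) = prox rho N (fun t => moved b (gamma' t)).
  by congr prox; apply/funext => t; rewrite fixedN.
rewrite e1 e2 in h4.
have h5 : prox rho N (fun t => fixed b (gamma t)) <= prox rho N (fun t => moved b (gamma' t)) + c0'.
  by rewrite /c0'; lra.
have := h4 h5.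
rewrite -[word p (a :: a' :: l)]/(fun v => word p (a' :: l) (act p a v)).
move: h5; rewrite -/(gamma' _); lra.
Unshelve. all: by end_near. Qed.

(** * The exponential curve *)

Section ExponentialCurve.
Variable s : C.
Hypothesis s1 : cmod s = 1.

Let es : entire (fun t => s * t).
Proof. exact: holM (hol_cst s) hol_id. Qed.

(** Jensen's inequality for [(e^w - 1) / w] at [w = s * t], whose modulus on the
    circle is [|e^w - 1|] divided by the radius. *)
Lemma prox_cexp_ge : exists c : R, forall rho, \forall N \near \oo,
  rho <= prox rho N (fun t => cexp (s * t)) + c.
Proof.
exists (1 + ln 2) => rho.
have J := @jensen R (fun t => cexpm1 (s * t)) rho (expR (- rho)) 1
  (hol_comp (@entire_cexpm1 R) es).
rewrite mulr0 cexpm1_0 cmod1 ln1 in J.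
have {}J := J (oner_neq0 _) (expR_gt0 _) ltr01.
near=> N.
have N0 : (0 < N)%N by near: N; exists 1%N.
have H : 0 <= cmean rho N (fun t => ln (Num.max (cmod (cexpm1 (s * t))) (expR (- rho)))) + 1.
  by near: N.
have Hle : cmean rho N (fun t => ln (Num.max (cmod (cexpm1 (s * t))) (expR (- rho)))) <=
    cmean rho N (fun t => logp (cexp (s * t)) + (ln 2 - rho)).
  apply: le_cmean => th _; set t := polar rho th.
  have ct : cmod (s * t) = expR rho by rewrite cmodM s1 mul1r cmod_polar.
  have m0 := mplus_gt0 (cexp (s * t)); have m1 := mplus_ge1 (cexp (s * t)).
  have er : 0 < expR (- rho) := expR_gt0 _.
  have -> : logp (cexp (s * t)) + (ln 2 - rho) =
      ln (mplus (cexp (s * t)) * (2 * expR (- rho))).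
    by rewrite !lnM ?posrE ?mulr_gt0// expRK.
  rewrite ler_ln ?posrE ?mulr_gt0// ?lt_max ?er ?orbT// ge_max; apply/andP; split.
    rewrite mulrA expRN ler_pdivlMr ?expR_gt0// -ct -cmodM mulrC.
    have -> : s * t * cexpm1 (s * t) = cexp (s * t) - 1 by rewrite cexp_expm1 addrAC subrr add0r.
    rewrite (le_trans (cmodB _ _))// cmod1.
    have := mplus_ge_cmod (cexp (s * t)); lra.
  rewrite mulrA ler_peMl ?(ltW er)//; lra.
move: Hle; rewrite cmeanD cmean_cst// -/(prox rho N (fun t => cexp (s * t))).
move: H; lra.
Unshelve. all: by end_near. Qed.

(** [log^+ |e^w| - log^+ |e^-w| = log |e^w|], and the mean of the right-hand side is
    at least [log |e^0| = 0] by Jensen's inequality. *)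
Lemma prox_cexpN_le rho : \forall N \near \oo,
  prox rho N (fun t => cexp (- (s * t))) <= prox rho N (fun t => cexp (s * t)) + 1.
Proof.
(* A lower bound of [|e^(s * t)|] on the circle, so that truncating at [eps] has
   no effect. *)
pose eps := expR (- expR rho).
have J := @jensen R (fun t => cexp (s * t)) rho eps 1
  (hol_comp (@entire_cexp R) es) (cexp_neq0 _) (expR_gt0 _) ltr01.
rewrite mulr0 cexp0 cmod1 ln1 in J.
near=> N.
have H : 0 <= cmean rho N (fun t => ln (Num.max (cmod (cexp (s * t))) eps)) + 1.
  by near: N.
have Hle : cmean rho N (fun t => ln (Num.max (cmod (cexp (s * t))) eps)) <=
    cmean rho N (fun t => logp (cexp (s * t)) - logp (cexp (- (s * t)))).
  apply: le_cmean => th _; set t := polar rho th.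
  have ct : cmod (s * t) = expR rho by rewrite cmodM s1 mul1r cmod_polar.
  have := Re_le_cmod (s * t); rewrite ct ler_norml => /andP[r1 _].
  rewrite /logp /mplus !cmod_cexp raddfN /=.
  move: (complex.Re _) r1 => x r1.
  rewrite (max_idPl _) ?ler_expR// expRK.
  have [x0|x0] := leP 0 x.
    rewrite (max_idPr _) ?expRK -?expR0 ?ler_expR// (max_idPl _) ?ler_expR ?oppr_le0//.
    by rewrite expRK subr0.
  rewrite (max_idPl _) -?expR0 ?ler_expR ?(ltW x0)// (max_idPr _) ?ler_expR ?oppr_ge0 ?(ltW x0)//.
  by rewrite !expRK sub0r opprK.
move: Hle; rewrite cmeanB -/(prox rho N (fun t => cexp (s * t))).
rewrite -/(prox rho N (fun t => cexp (- (s * t)))).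
move: H; lra.
Unshelve. all: by end_near. Qed.

End ExponentialCurve.

(** * The exponential map *)

Hypothesis simple_zeros : forall a : C, root p a -> mup a p = 1%N.

Lemma exists_nonroot : exists z : C, p.[z] != 0.
Proof.
apply: contrapT => H; have rp (n : nat) : p.[n%:R] = 0.
  by apply/eqP; apply/negP => /negP h; apply: H; exists n%:R.
pose rs : seq C := [seq n%:R | n <- iota 0 (size p)].
have := @max_poly_roots _ p rs p_neq0; rewrite size_map size_iota ltnn => /(_ _ _)/negP.
apply => //.
  by apply/allP => _ /mapP[n _ ->]; apply/eqP.
rewrite map_inj_uniq ?iota_uniq// => m n /eqP.
by rewrite eqr_nat => /eqP.
Qed.

Lemma hol_exp_fun : hol (@exp_fun R).
Proof.
have -> : @exp_fun R = fun v => (v.1.1 * cexp v.2, v.1.2 * cexp (- v.2), v.2).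
  by apply/funext => -[[x y] z].
have hz : hol (fun v : C3 => v.2) by apply: hol_snd.
have hx : hol (fun v : C3 => v.1.1) by apply: hol_fst; apply: hol_fst.
have hy : hol (fun v : C3 => v.1.2) by apply: hol_snd; apply: hol_fst.
apply: hol_pair => //; apply: hol_pair; apply: holM => //.
  by apply: (hol_comp (@entire_cexp R)).
by apply: (hol_comp (hol_comp (@entire_cexp R) (holN hol_id))).
Qed.

Lemma exp_map_hol_aut : hol_aut p (exp_map p).
Proof.
pose psi := @swap R p \o exp_map p \o @swap R p.
have h (v : danielewski p) : val (exp_map p v) = exp_fun (val v) by [].
have h' (v : danielewski p) : val (psi v) = swap_fun (exp_fun (swap_fun (val v))) by [].
split; first exact: (holomorphic_of_hol hol_exp_fun h).
exists psi; split.
- apply: (holomorphic_of_hol _ h') => v.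
  apply: (@differentiable_comp _ _ _ _ (fun v => exp_fun (swap_fun v)) (@swap_fun R)).
    apply: (@differentiable_comp _ _ _ _ (@swap_fun R) (@exp_fun R)).
      exact: hol_swap.
    exact: hol_exp_fun.
  exact: hol_swap.
- move=> v; apply: val_inj; rewrite h' h; move: (val v) => [[x y] z].
  rewrite /exp_fun /swap_fun /=; congr (_, _, _).
    by rewrite -mulrA cexpK mulr1.
  by rewrite -mulrA [_ * cexp z]mulrC cexpK mulr1.
- move=> v; apply: val_inj; rewrite h h'; move: (val v) => [[x y] z].
  rewrite /exp_fun /swap_fun /=; congr (_, _, _).
    by rewrite -mulrA [_ * cexp z]mulrC cexpK mulr1.
  by rewrite -mulrA cexpK mulr1.
Qed.

Lemma exp_map_neq_id : exp_map p <> id.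
Proof.
move=> E; have on1 : on_danielewski p (1, p.[1], 1) by rewrite /on_danielewski mul1r.
have := congr1 (fun phi : danielewski p -> danielewski p => (val (phi (exist (on_danielewski p) _ on1))).1.1) E.
rewrite /= mul1r => /(congr1 (@cmod R)); rewrite cmod_cexp cmod1 => /eqP.
by rewrite gt_eqF// -expR0 ltr_expR.
Qed.

(** The curve starts at a generic point with [x0 * y0 != 0]; [s] is [1] or [-1]
    according to the coordinate fixed by the first letter. *)
Lemma exp_map_not_overshear : ~ overshear_group p (exp_map p).
Proof.
move=> /overshear_group_word[l0 /reduce_word-/(_ p)[l [hl rl E0]] E].
have {}E (v : danielewski p) : exp_fun (val v) = word p l (val v).
  by rewrite E0 -val_wordD -E.
case: l hl rl E {E0} => [|a l] hl rl E.
  by apply: exp_map_neq_id; apply/funext => v; apply: val_inj; exact: E.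
have [z1 pz1] := exists_nonroot.
pose U : set C3 := [set v | v.1.1 * v.1.2 != 0].
have oU : open U.
  have hxy : hol (fun v : C3 => v.1.1 * v.1.2).
    by apply: holM; [apply: hol_fst; apply: hol_fst|apply: hol_snd; apply: hol_fst].
  exact: open_neq0 hxy.
have U1 : U (1, p.[z1], z1) by rewrite /U /= mul1r.
have D1 : on_D p (1, p.[z1], z1) by rewrite /on_D /= mul1r.
have [[[x0 y0] z0] [U0 D0 g0]] := generic_dense simple_zeros p_neq0 hl rl oU U1 D1.
have [x00 y00] : x0 != 0 /\ y0 != 0 by move: U0; rewrite /U /= mulf_eq0 negb_or => /andP.
pose gamma (t : C) : C3 := (x0 * cexp t, y0 * cexp (- t), z0).
have Dg t : on_D p (gamma t).
  by rewrite /on_D /= mulrACA cexpK mulr1; exact: D0.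
have hg : hol gamma.
  apply: hol_pair; last exact: hol_cst.
  apply: hol_pair; apply: holM; try exact: hol_cst.
    exact: (@entire_cexp R).
  exact: (hol_comp (@entire_cexp R) (holN hol_id)).
have g0' : generic p (a :: l) (gamma 0) by rewrite /gamma oppr0 cexp0 !mulr1.
set b := side a.
pose s : C := if b then -1 else 1.
pose al := if b then y0 else x0; pose be := if b then x0 else y0.
have s1 : cmod s = 1 by rewrite /s; case: (b); rewrite ?cmodN cmod1.
have al0 : al != 0 by rewrite /al; case: (b).
have fixE t : fixed b (gamma t) = al * cexp (s * t).
  by rewrite /fixed /al /s; case: (b); rewrite ?mulN1r ?mul1r.
have movE t : moved b (gamma t) = be * cexp (- (s * t)).
  by rewrite /moved /be /s; case: (b); rewrite ?mulN1r ?mul1r ?opprK.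
have zE t : (word p (a :: l) (gamma t)).2 = z0.
  have on : on_danielewski p (gamma t) by apply/on_DP.
  by rewrite -(E (exist (on_danielewski p) _ on)).
have [c Hc] := @growth (a :: l) gamma b (logp be + 1 + logp al^-1) hl rl erefl hg Dg g0'.
have [c1 Hc1] := prox_cexp_ge s1.
pose rho := c1 + logp al^-1 + 2 * logp z0 + c + 1.
suff : \forall N \near \oo, rho <= rho - 1.
  by move=> [N _ /(_ N (leqnn N))] /=; lra.
near=> N.
have N0 : (0 < N)%N by near: N; exists 1%N.
have h1 : rho <= prox rho N (fun t => cexp (s * t)) + c1 by near: N; exact: Hc1.
have h2 : prox rho N (fun t => cexp (- (s * t))) <= prox rho N (fun t => cexp (s * t)) + 1.
  by near: N; exact: prox_cexpN_le.
have h3 : prox rho N (fun t => moved b (gamma t)) <=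
    prox rho N (fun t => fixed b (gamma t)) + (logp be + 1 + logp al^-1) ->
    prox rho N (fun t => fixed b (gamma t)) <=
    2 * prox rho N (fun t => (word p (a :: l) (gamma t)).2) + c.
  by near: N; exact: Hc.
have h4 : prox rho N (fun t => moved b (gamma t)) <= logp be + prox rho N (fun t => cexp (- (s * t))).
  rewrite -[logp be](cmean_cst rho _ N0) /prox -cmeanD; apply: le_cmean => th _.
  by rewrite movE logpM.
have h5 : prox rho N (fun t => cexp (s * t)) <= logp al^-1 + prox rho N (fun t => fixed b (gamma t)).
  rewrite -[logp al^-1](cmean_cst rho _ N0) /prox -cmeanD; apply: le_cmean => th _.
  by rewrite fixE (le_trans _ (logpM _ _))// mulKf.
have h6 : prox rho N (fun t => (word p (a :: l) (gamma t)).2) = logp z0.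
  rewrite -[RHS](prox_cst rho z0 N0); congr prox.
  by apply/funext => t; exact: zE.
rewrite h6 in h3.
have {}h3 := h3 ltac:(lra).
rewrite /rho in h1 h2 h3 h4 h5 *; lra.
Unshelve. all: by end_near. Qed.

End Growth.

Theorem corollary5p7 (R : realType) (p : {poly CC R})
    (simple_zeros : forall a : CC R, root p a -> mup a p = 1%N)
    (deg_p : (4 <= (size p).-1)%N) :
  [/\ hol_aut p (exp_map p),
      ~ overshear_group p (exp_map p),
      is_subgroup (hol_aut p) (overshear_group p) &
      overshear_group p `<` hol_aut p].
Proof.
have nE := exp_map_not_overshear deg_p simple_zeros.
have hE := exp_map_hol_aut p.
have [sub_aut h1 h2 h3] := overshear_group_subgroup p.
split => //; split; first exact: sub_aut.
by move=> /(_ _ hE).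
Qed.
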